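(* Let $(\mathcal{M},\tau)$ be a non-commutative probability space and let $\{X_i\}_{i\ge1}\subset\mathcal{M}$ be a sequence of Boolean independent and identically distributed self-adjoint random variables with symmetric law $\mu$. Define $$S_n:=\frac{X_1+\cdots+X_n}{\sqrt{n}}.$$ Then for any $n\ge1$, $$\Gamma^*(S_n)=\Gamma^*(X_1)\qquad\text{and}\qquad\Psi^*(S_n)=\Psi^*(X_1).$$
   Context: A non-commutative probability space $(\mathcal{M},\tau)$ is a von Neumann algebra $\mathcal{M}$ with a nondegenerate normal state $\tau$, not necessarily faithful. For self-adjoint $A\in\mathcal{M}$, the law of $A$ is the unique probability measure $\mu$ on $\mathbb{R}$ with $\tau(A^k)=\int x^k\,d\mu(x)$ for all $k\in\mathbb{N}$. A family of self-adjoint elements $(X_i)$ is Boolean independent if $\tau(X_{i_1}^{k_1}X_{i_2}^{k_2}\cdots X_{i_p}^{k_p})=\tau(X_{i_1}^{k_1})\tau(X_{i_2}^{k_2})\cdots\tau(X_{i_p}^{k_p})$ for all $p\ge1$, all $k_1,\ldots,k_p\ge1$ and all indices with $i_1\ne i_2,\ i_2\ne i_3,\ldots,i_{p-1}\ne i_p$. Sums of Boolean independent variables with symmetric laws have symmetric laws. For $X$ self-adjoint with symmetric law $\mu$, the Non-microstates Boolean Fisher information and entropy are $$\Psi^*(X)=\int\frac1{x^2}\,d\mu(x)\in(0,+\infty],\qquad\Gamma^*(X)=-\frac12\log\int\frac1{x^2}\,d\mu(x)\in[-\infty,+\infty),$$ with $1/0=+\infty$ and $\log(+\infty)=+\infty$.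 *)

(* Defs.v *)
From HB Require Import structures.
From mathcomp Require Import all_boot all_order all_algebra.
From mathcomp Require Import all_classical all_reals all_analysis.
From mathcomp Require Export complex.

Set Implicit Arguments.
Unset Strict Implicit.
Unset Printing Implicit Defensive.

Import Order.TTheory GRing.Theory Num.Theory numFieldNormedType.Exports.
Local Open Scope classical_set_scope.
Local Open Scope ring_scope.
Local Open Scope complex_scope.

Section Operators.
Variables (R : realType) (H : completeNormedModType R[i]).
(* Linear in the first argument, conjugate-linear in the second. *)
Variable dot : {dot H for (@Num.conj R[i])}.

Definition bounded_operator (A : H -> H) : Prop := linear A /\ continuous A.

Definition adjoint_of (A B : H -> H) : Prop :=
  forall u v, dot (A u) v = dot u (B v).

Definition selfadjoint (A : H -> H) : Prop := adjoint_of A A.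

(* On R[i], x <= y means that y - x is real and nonnegative. *)
Definition positive_operator (A : H -> H) : Prop :=
  forall u, 0 <= dot (A u) u.

Definition operator_le (A B : H -> H) : Prop := positive_operator (B - A).

(* A von Neumann algebra of operators on H: a unital *-algebra of bounded
   operators which is closed in the weak operator topology. *)
Record von_neumann_algebra (M : set (H -> H)) : Prop := {
  vna_bounded : forall A, M A -> bounded_operator A;
  vna_id : M id;
  vna_lin : forall (c : R[i]) A B, M A -> M B -> M (c *: A + B);
  vna_comp : forall A B, M A -> M B -> M (A \o B);
  vna_adjoint : forall A, M A -> exists2 B, M B & adjoint_of A B;
  vna_wot_closed : forall T, bounded_operator T ->
    (forall (s : seq (H * H)) (e : R[i]), 0 < e ->
      exists2 A, M A &
        forall uv, uv \in s -> `|dot (T uv.1 - A uv.1) uv.2| < e) ->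
    M T
}.

Definition selfadjoint_part (M : set (H -> H)) : set (H -> H) :=
  [set A | M A /\ selfadjoint A].

Definition directed (D : set (H -> H)) : Prop :=
  D !=set0 /\ forall A B, D A -> D B ->
    exists C, [/\ D C, operator_le A C & operator_le B C].

Definition operator_sup (M D : set (H -> H)) (T : H -> H) : Prop :=
  [/\ selfadjoint_part M T,
      forall A, D A -> operator_le A T &
      forall B, selfadjoint_part M B ->
        (forall A, D A -> operator_le A B) -> operator_le T B].

Record normal_state (M : set (H -> H)) (tau : (H -> H) -> R[i]) : Prop := {
  state_lin : forall (c : R[i]) A B, M A -> M B ->
    tau (c *: A + B) = c * tau A + tau B;
  state_ge0 : forall A, M A -> positive_operator A -> 0 <= tau A;
  state_id : tau id = 1;
  state_normal : forall D T, D `<=` selfadjoint_part M -> directed D ->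
    operator_sup M D T -> supremums (tau @` D) (tau T)
}.

(* Faithfulness of the GNS representation of tau; weaker than faithfulness
   of tau itself. *)
Definition nondegenerate_state (M : set (H -> H)) (tau : (H -> H) -> R[i])
    : Prop :=
  forall A, M A -> (forall B C, M B -> M C -> tau (B \o A \o C) = 0) -> A = 0.

End Operators.

Record ncps (R : realType) := NCPS {
  hilbert : completeNormedModType R[i];
  inner : {dot hilbert for (@Num.conj R[i])};
  inner_norm : forall u : hilbert, inner u u = `|u| ^+ 2;
  alg : set (hilbert -> hilbert);
  alg_vna : von_neumann_algebra inner alg;
  (* only the values on alg are meaningful *)
  state : (hilbert -> hilbert) -> R[i];
  state_is_normal : normal_state inner alg state;
  state_nondegenerate : nondegenerate_state alg state
}.

Arguments inner {R} n.
Arguments alg {R} n.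
Arguments state {R} n.

Section Laws.
Variables (R : realType) (P : ncps R).
Local Notation H := (hilbert P).

Definition nc_variable (A : H -> H) : Prop :=
  selfadjoint_part (inner P) (alg P) A.

Definition is_law (A : H -> H) (mu : probability (measurableTypeR R) R)
    : Prop :=
  forall k : nat,
    mu.-integrable setT (fun x : R => (x ^+ k)%:E) /\
    state P (iter k A) = (\int[mu]_x (x ^+ k : R))%:C.

(* [get] picks the probability satisfying is_law; existence and uniqueness
   hold for every self-adjoint element of the algebra. *)
Definition law (A : H -> H) : probability (measurableTypeR R) R :=
  get [set mu : probability (measurableTypeR R) R | is_law A mu].

(* With [:: (i_1, k_1); ...; (i_p, k_p)] standing for
   X_{i_1}^{k_1} ... X_{i_p}^{k_p}. *)
Definition word_operator (I : Type) (X : I -> H -> H) (w : seq (I * nat))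
    : H -> H :=
  foldr (fun a T => iter a.2 (X a.1) \o T) id w.

Definition boolean_independent (I : eqType) (X : I -> H -> H) : Prop :=
  forall w : seq (I * nat), (0 < size w)%N ->
    all (fun a => (0 < a.2)%N) w ->
    sorted (fun a b => a.1 != b.1) w ->
    state P (word_operator X w) = \prod_(a <- w) state P (iter a.2 (X a.1)).

(* The inverse is the one of \bar R, for which 0^-1 = +oo. *)
Definition boolean_fisher (A : H -> H) : \bar R :=
  (\int[law A]_x ((x ^+ 2 : R)%:E)^-1)%E.

(* lne is the extended logarithm, with lne +oo = +oo. *)
Definition boolean_entropy (A : H -> H) : \bar R :=
  (- (2^-1)%:E * lne (boolean_fisher A))%E.

(* X i is the (i+1)-st variable of the sequence. *)
Definition normalized_sum (X : nat -> H -> H) (n : nat) : H -> H :=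
  ((Num.sqrt (n%:R : R))^-1)%:C *: \sum_(i < n) X i.

End Laws.

Definition symmetric_law (R : realType)
    (mu : probability (measurableTypeR R) R) : Prop :=
  forall B : set R, measurable B -> mu (-%R @` B) = mu B.

(* Main.v *)
From HB Require Import structures.
Require Import Defs.
From mathcomp Require Import all_boot all_order all_algebra.
From mathcomp Require Import all_classical all_reals all_analysis.
From mathcomp Require Import measurable_realfun.
From mathcomp Require Import ring lra zify.

(* Let Sig = X_1 + ... + X_n = sqrt n S_n, kappa = 1 - 1/n, and choose D so large
   that X_1^2 and Sig^2 have spectrum in [0, D]. Expanding 1/x^2 in powers of
   1 - x^2/D gives
     Psi(X_1) = D^-1 sum_k a_k   and   Psi(S_n) = (n/D) sum_k b_k
   with a_k = tau((1 - X_1^2/D)^k) and b_k = tau((1 - Sig^2/D)^k), so one has to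
   show sum b_k = (1/n) sum a_k in [0, +oo]. Boolean independence gives
     tau(p(X_1) (Sig - X_1) q(Sig)) = kappa tau(p(X_1)) tau(Sig q(Sig)),
   which, with Sig^2 - X_1^2 = X_1 (Sig - X_1) + (Sig - X_1) Sig and
   tau(X_1 p(X_1)) = 0 for even p, telescopes into
     a_k - b_k = kappa sum_(i < k) a_i (b_(k-1-i) - b_(k-i)).
   Summing over k < N yields
     sum_(k < N) b_k = (1 - kappa) sum_(k < N) a_k + kappa (a * b)_(N-1),
   and the convolution term tends to 0 as soon as sum a_k is finite.

   All this only involves moments, so that uniqueness of laws is not needed, but
   the existence of the law of S_n is: it is a Hausdorff moment problem, solved by
   taking a limit along an ultrafilter of the quantile functions of the discrete
   laws with Bernstein weights. *)

Set Implicit Arguments.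
Unset Strict Implicit.
Unset Printing Implicit Defensive.

Import Order.TTheory GRing.Theory Num.Theory numFieldNormedType.Exports.
Local Open Scope classical_set_scope.
Local Open Scope ring_scope.
Local Open Scope complex_scope.

(** * Polynomials in a self-adjoint element *)

Section MomentForm.
Variables (R : comNzRingType) (m : nat -> R).

(** The Riesz functional of the sequence [m]. *)
Definition moment_form (p : {poly R}) : R := \sum_(i < size p) p`_i * m i.

Lemma moment_form_widen n (p : {poly R}) : (size p <= n)%N ->
  moment_form p = \sum_(i < n) p`_i * m i.
Proof.
move=> pn; rewrite /moment_form (big_ord_widen n (fun i => p`_i * m i) pn).
rewrite big_mkcond /=; apply: eq_bigr => i _; case: ltnP => // pi.
by rewrite nth_default// mul0r.
Qed.

Fact moment_form_is_scalar : scalar moment_form.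
Proof.
move=> a p q; set n := maxn (size (a *: p + q)) (maxn (size p) (size q)).
rewrite !(@moment_form_widen n) ?leq_max ?leqnn ?orbT//.
rewrite mulr_sumr -big_split /=; apply: eq_bigr => i _.
by rewrite coefD coefZ mulrDl mulrA.
Qed.
HB.instance Definition _ :=
  GRing.isLinear.Build R {poly R} R *%R moment_form moment_form_is_scalar.

Lemma moment_formXn i : moment_form 'X^i = m i.
Proof.
rewrite /moment_form size_polyXn big_ord_recr /= big1 => [|j _].
  by rewrite coefXn eqxx mul1r add0r.
by rewrite coefXn ltn_eqF// mul0r.
Qed.

End MomentForm.

Lemma poly_linear_ext (R : comNzRingType) (V : lmodType R)
    (f g : {linear {poly R} -> V}) :
  (forall i, f 'X^i = g 'X^i) -> f =1 g.
Proof.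
move=> fg p; rewrite -[p]coefK poly_def !linear_sum; apply: eq_bigr => i _.
by rewrite !linearZ fg.
Qed.

Section Observables.
Variables (R : realType) (P : ncps R).
Local Notation H := (hilbert P).
Local Notation M := (alg P).
Local Notation tau := (state P).
Implicit Types (A B : H -> H) (p q : {poly R}).

Lemma alg_linear A : M A -> linear A.
Proof. by case/(vna_bounded (alg_vna P)). Qed.

Lemma alg0 : M 0.
Proof.
rewrite [0](_ : _ = (-1) *: id + (id : H -> H)); last first.
  by apply/funext => u; rewrite /= scaleN1r addNr.
by apply: (vna_lin (alg_vna P)); exact: (vna_id (alg_vna P)).
Qed.

Lemma algD A B : M A -> M B -> M (A + B).
Proof. by move=> MA MB; rewrite -[A]scale1r; exact: (vna_lin (alg_vna P)). Qed.

Lemma algZ c A : M A -> M (c *: A).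
Proof. by move=> MA; rewrite -[X in M X]addr0; exact: (vna_lin (alg_vna P) _ _ alg0). Qed.

Lemma alg_sum (I : Type) (r : seq I) (F : I -> H -> H) :
  (forall i, M (F i)) -> M (\sum_(i <- r) F i).
Proof. by move=> MF; elim/big_ind: _ => //; [exact: alg0|exact: algD]. Qed.

Lemma alg_comp A B : M A -> M B -> M (A \o B).
Proof. exact: (vna_comp (alg_vna P)). Qed.

Lemma alg_iter A k : M A -> M (iter k A).
Proof.
move=> MA; elim: k => [|k IH]; first exact: (vna_id (alg_vna P)).
exact: alg_comp MA IH.
Qed.

Lemma stateD A B : M A -> M B -> tau (A + B) = tau A + tau B.
Proof.
move=> MA MB; rewrite -[A in LHS]scale1r.
by rewrite (state_lin (state_is_normal P))// mul1r.
Qed.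

Lemma state0 : tau 0 = 0.
Proof. by apply: (addrI (tau 0)); rewrite addr0 -stateD ?addr0//; exact: alg0. Qed.

Lemma stateZ c A : M A -> tau (c *: A) = c * tau A.
Proof.
move=> MA; rewrite -[X in tau X]addr0.
by rewrite (state_lin (state_is_normal P) _ MA alg0) state0 addr0.
Qed.

Lemma state_sum (I : Type) (r : seq I) (F : I -> H -> H) :
  (forall i, M (F i)) -> tau (\sum_(i <- r) F i) = \sum_(i <- r) tau (F i).
Proof.
move=> MF; elim: r => [|i r IH]; first by rewrite !big_nil state0.
by rewrite !big_cons stateD ?IH//; exact: alg_sum.
Qed.

Lemma linear_comp_sum A (I : Type) (r : seq I) (F : I -> H -> H) :
  linear A -> A \o (\sum_(i <- r) F i) = \sum_(i <- r) (A \o F i).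
Proof.
move=> lA; pose a : {linear H -> H} := HB.pack A (GRing.isLinear.Build _ _ _ _ A lA).
apply/funext => u; rewrite /= !fct_sumE.
exact: (linear_sum a).
Qed.

Lemma linear_compZ A c B : linear A -> A \o (c *: B) = c *: (A \o B).
Proof.
move=> lA; pose a : {linear H -> H} := HB.pack A (GRing.isLinear.Build _ _ _ _ A lA).
by apply/funext => u; exact: (linearZ_LR a).
Qed.

Lemma iter_linear A k : linear A -> linear (iter k A).
Proof. by move=> lA; elim: k => [|k IH]// c u v /=; rewrite IH lA. Qed.

Lemma iter_scale A c k : linear A -> iter k (c *: A) = c ^+ k *: iter k A.
Proof.
move=> lA; elim: k => [|k IH]; first by rewrite scale1r.
rewrite exprS -scalerA -[iter k.+1 A]/(A \o iter k A) -(linear_compZ _ _ lA) -IH.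
by apply/funext => u.
Qed.

(** A functional calculus with real coefficients, so that self-adjointness passes from [A] to
    [op_horner A p]. *)
Definition op_horner A p : H -> H := \sum_(i < size p) (p`_i)%:C *: iter i A.

Lemma op_hornerE A p u :
  op_horner A p u = \sum_(i < size p) (p`_i)%:C *: iter i A u.
Proof. by rewrite /op_horner fct_sumE. Qed.

Lemma op_horner_widen n A p : (size p <= n)%N ->
  op_horner A p = \sum_(i < n) (p`_i)%:C *: iter i A.
Proof.
move=> pn; rewrite /op_horner.
rewrite (big_ord_widen n (fun i => (p`_i)%:C *: iter i A) pn).
rewrite big_mkcond /=; apply: eq_bigr => i _; case: ltnP => // pi.
by rewrite nth_default// scale0r.
Qed.

Lemma op_hornerD A p q : op_horner A (p + q) = op_horner A p + op_horner A q.
Proof.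
set n := maxn (size (p + q)) (maxn (size p) (size q)).
rewrite !(@op_horner_widen n) ?leq_max ?leqnn ?orbT//.
rewrite -big_split /=; apply: eq_bigr => i _.
by rewrite coefD rmorphD scalerDl.
Qed.

Lemma op_hornerC A c : op_horner A c%:P = c%:C *: id.
Proof.
rewrite (@op_horner_widen 1) ?size_polyC_leq1//.
by rewrite big_ord1 coefC.
Qed.

Lemma op_hornerMX A p : op_horner A (p * 'X) = op_horner A p \o A.
Proof.
rewrite (@op_horner_widen (size p).+1); last first.
  by rewrite (leq_trans (size_polyMleq _ _))// size_polyX addn2.
rewrite big_ord_recl coefMX eqxx scale0r add0r.
apply/funext => u; rewrite /= op_hornerE fct_sumE; apply: eq_bigr => i _.
by rewrite coefMX /bump /= add1n /= -iterSr.
Qed.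

Lemma op_horner_alg A p : M A -> M (op_horner A p).
Proof. by move=> MA; apply: alg_sum => i; exact/algZ/alg_iter. Qed.

(** Operators are bare functions: composition distributes over a sum in its left factor by
    definition, but over a sum in its right factor only because [A], hence [op_horner A p], is
    linear. *)
Lemma op_hornerM A p q : linear A ->
  op_horner A (p * q) = op_horner A p \o op_horner A q.
Proof.
move=> lA; have lpA : linear (op_horner A p).
  move=> c u v; rewrite !op_hornerE scaler_sumr -big_split; apply: eq_bigr => i _.
  by rewrite iter_linear// scalerDr !scalerA mulrC.
elim/poly_ind: q => [|q c IH].
  rewrite mulr0 /op_horner size_poly0 !big_ord0; apply/funext => u.
  have := lpA (-1) 0 0; rewrite scaler0 addr0 scaleN1r addNr => lpA0.
  by rewrite -[RHS]/(op_horner A p 0) lpA0.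
rewrite mulrDr mulrA op_hornerD op_hornerMX IH op_hornerD op_hornerMX op_hornerC.
have -> : op_horner A (p * c%:P) = c%:C *: op_horner A p.
  rewrite mulrC mul_polyC (@op_horner_widen (size p)) ?size_scale_leq//.
  rewrite scaler_sumr; apply: eq_bigr => i _.
  by rewrite coefZ rmorphM scalerA.
apply/funext => u /=; rewrite [RHS](_ : _ = op_horner A p (c%:C *: u + op_horner A q (A u))).
  by rewrite lpA addrC.
by rewrite addrC.
Qed.

(** On self-adjoint elements of the algebra the real part loses nothing, by [state_iter_real]. *)
Definition op_moment A k : R := complex.Re (tau (iter k A)).

Lemma selfadjoint_iter A k : selfadjoint (inner P) A ->
  selfadjoint (inner P) (iter k A).
Proof.
by move=> sA; elim: k => [|k IH] u v //=; rewrite sA IH -iterSr.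
Qed.

Lemma selfadjoint_op_horner A p : selfadjoint (inner P) A ->
  selfadjoint (inner P) (op_horner A p).
Proof.
move=> sA u v; rewrite !op_hornerE linear_sumlz linear_sumr.
apply: eq_bigr => i _; rewrite linearZl_LR linearZr_LR /= selfadjoint_iter//.
by rewrite conj_Creal ?complex_real.
Qed.

(** Continuity of a linear map is boundedness. In this squared form, and for self-adjoint [A], the
    bound says that c^2 - A^2 is a positive operator. *)
Lemma nc_variable_bounded A : nc_variable A ->
  exists2 c : R, 0 < c &
    forall u, inner P (A u) (A u) <= (c ^+ 2)%:C * inner P u u.
Proof.
case=> MA _; have [lA cA] := vna_bounded (alg_vna P) MA.
pose a : {linear H -> H} := HB.pack A (GRing.isLinear.Build _ _ _ _ A lA).
have /linear_boundedP/pinfty_ex_gt0[r r0 Hr] : bounded_near a (nbhs 0).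
  exact/linear_bounded_continuous.
(* Being positive in the order of [R[i]], [r] is a real number. *)
have rE : r = (complex.Re r)%:C by rewrite RRe_real// gtr0_real.
exists (complex.Re r); first by rewrite -ltcR -rE.
move=> u; rewrite !inner_norm rmorphXn /= -rE -exprMn.
by rewrite lerXn2r ?nnegrE ?mulr_ge0 ?(ltW r0)//; exact: Hr.
Qed.

Lemma state_op_hornerE A p : M A ->
  tau (op_horner A p) = \sum_(i < size p) (p`_i)%:C * tau (iter i A).
Proof.
move=> MA; rewrite state_sum => [|i]; last exact/algZ/alg_iter.
by apply: eq_bigr => i _; rewrite stateZ//; exact: alg_iter.
Qed.

(** Since p(A) is self-adjoint, the quadratic form of p(A)^2 at u is |p(A) u|^2. *)
Lemma state_op_horner_sqr_ge0 A p : nc_variable A ->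
  0 <= tau (op_horner A (p ^+ 2)).
Proof.
move=> [MA sA]; apply: (state_ge0 (state_is_normal P)); first exact: op_horner_alg.
move=> u; rewrite expr2 op_hornerM; last exact: alg_linear.
by rewrite /= selfadjoint_op_horner// dnorm_ge0.
Qed.

(** By polarization, 2 A^k = (A^k + 1)^2 - (A^k)^2 - 1, and [tau] is nonnegative, hence real, on
    each square. *)
Lemma state_iter_real A k : nc_variable A ->
  tau (iter k A) = (op_moment A k)%:C.
Proof.
move=> vA; have [MA _] := vA; rewrite /op_moment RRe_real//.
have opE p q : tau (op_horner A (p + q)) =
    tau (op_horner A p) + tau (op_horner A q).
  by rewrite op_hornerD stateD//; exact: op_horner_alg.
have opX i : tau (op_horner A 'X^i) = tau (iter i A).
  rewrite state_op_hornerE// size_polyXn big_ord_recr /= big1 => [|j _].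
    by rewrite coefXn eqxx mul1r add0r.
  by rewrite coefXn ltn_eqF// mul0r.
have realsq p : tau (op_horner A (p ^+ 2)) \is Num.real.
  by rewrite ger0_real// state_op_horner_sqr_ge0.
have := realsq ('X^k + 1); rewrite sqrrD mulr1 expr1n opE opE mulr2n opE opX.
rewrite rpredDr; last by rewrite -[1](expr1n _ 2).
rewrite rpredDl; last by [].
by rewrite -mulr2n realrMn.
Qed.

Lemma state_op_horner A p : nc_variable A ->
  tau (op_horner A p) = (moment_form (op_moment A) p)%:C.
Proof.
move=> vA; have [MA _] := vA; rewrite state_op_hornerE// rmorph_sum.
by apply: eq_bigr => i _; rewrite rmorphM /= state_iter_real.
Qed.

Lemma op_moment_sqr_ge0 A p : nc_variable A ->
  0 <= moment_form (op_moment A) (p ^+ 2).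
Proof.
by move=> vA; rewrite -lecR -state_op_horner// state_op_horner_sqr_ge0.
Qed.

(** As p(A) is self-adjoint and commutes with c^2 - A^2, the quadratic form of the product at u is
    that of c^2 - A^2 at p(A) u. *)
Lemma op_moment_bounded_ge0 A c p : nc_variable A ->
  (forall u, inner P (A u) (A u) <= (c ^+ 2)%:C * inner P u u) ->
  0 <= moment_form (op_moment A) (((c ^+ 2)%:P - 'X^2) * p ^+ 2).
Proof.
move=> vA Ac; have [MA sA] := vA; rewrite -lecR -state_op_horner//.
apply: (state_ge0 (state_is_normal P)); first exact: op_horner_alg.
have lA := alg_linear MA.
move=> u; rewrite expr2 mulrCA !op_hornerM//= selfadjoint_op_horner//.
set v := op_horner A p u.
have -> : op_horner A ((c ^+ 2)%:P - 'X^2) v = (c ^+ 2)%:C *: v - A (A v).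
  rewrite (_ : - 'X^2 = (-1)%:P * 'X * 'X); last by rewrite polyCN mulN1r mulNr.
  rewrite op_hornerD !op_hornerMX !op_hornerC rmorphN rmorph1.
  by rewrite -[A (A v)]scale1r -scaleNr.
by rewrite linearBl linearZl_LR /= sA subr_ge0.
Qed.

Lemma op_moment0 A : op_moment A 0 = 1.
Proof. by rewrite /op_moment (state_id (state_is_normal P)). Qed.

End Observables.

(** * Sums of Boolean independent variables *)

Section BooleanSums.
Variables (R : realType) (P : ncps R) (X : nat -> hilbert P -> hilbert P).
Local Notation tau := (state P).
Hypothesis algX : forall i, alg P (X i).
Hypothesis indX : boolean_independent X.
Hypothesis eqX : forall i k, tau (iter k (X i)) = tau (iter k (X 0%N)).
Variable n : nat.
Let Sig := \sum_(i < n) X i.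
Let alt (a b : nat * nat) := a.1 != b.1.
Let pos (a : nat * nat) := (0 < a.2)%N.

Let alg_Sig : alg P Sig.
Proof. exact: alg_sum. Qed.

Lemma word_operator_rcons w c :
  word_operator X (rcons w c) = word_operator X w \o iter c.2 (X c.1).
Proof. by elim: w => //= a w ->. Qed.

Lemma alg_word w : alg P (word_operator X w).
Proof.
elim: w => [|a w IH]; first exact: (vna_id (alg_vna P)).
exact: alg_comp (alg_iter _ _) IH.
Qed.

Lemma comp_iterS_sum A l : alg P A ->
  A \o iter l.+1 Sig = \sum_(i < n) (A \o X i \o iter l Sig).
Proof.
move=> MA; rewrite -[LHS]/((A \o Sig) \o iter l Sig).
rewrite linear_comp_sum; last exact: alg_linear.
by apply/funext => u; rewrite /= !fct_sumE.
Qed.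

Lemma state_comp_iterS A l : alg P A ->
  tau (A \o iter l.+1 Sig) = \sum_(i < n) tau (A \o X i \o iter l Sig).
Proof.
move=> MA; rewrite comp_iterS_sum// state_sum// => i.
by apply: alg_comp; [exact: alg_comp|exact: alg_iter].
Qed.

(** Induction on [l], expanding the leftmost Sig: each X_i lengthens the last block or opens a new
    one, so the word stays alternating. The nonempty tail [rcons w b] shields the block [a] from
    merging. Once no Sig is left, Boolean independence applies to both words. *)
Lemma state_first_block l a w b : pos a -> all pos (rcons w b) ->
    path alt a (rcons w b) ->
  tau (word_operator X (a :: rcons w b) \o iter l Sig) =
  tau (iter a.2 (X a.1)) * tau (word_operator X (rcons w b) \o iter l Sig).
Proof.
move=> a0; elim: l w b => [|l IH] w b wb0 awb.
  have -> (f : hilbert P -> hilbert P) : f \o iter 0 Sig = f by [].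
  rewrite !indX ?big_cons ?size_rcons//; first exact: path_sorted awb.
  by apply/andP; split.
rewrite !state_comp_iterS; try exact: alg_word.
rewrite mulr_sumr; apply: eq_bigr => i _.
have wX : word_operator X (rcons w b) \o X i = word_operator X
    (if b.1 == i then rcons w (b.1, b.2.+1) else rcons (rcons w b) (nat_of_ord i, 1%N)).
  case: eqP => [bi|_]; rewrite !word_operator_rcons//=.
  by apply/funext => u; rewrite -bi [RHS]/= -iterS iterSr.
have -> : word_operator X (a :: rcons w b) \o X i =
    iter a.2 (X a.1) \o (word_operator X (rcons w b) \o X i) by [].
rewrite wX; move: wb0 awb; rewrite all_rcons rcons_path => /andP[b0 w0] /andP[aw wb].
case: ifP => bi; apply: IH; rewrite ?all_rcons ?rcons_path//=.
- exact/andP.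
- exact/andP.
- by rewrite aw wb last_rcons /alt /= bi.
Qed.

Lemma state_iter_comp_iterS i j l :
  tau (iter j (X i) \o iter l.+1 Sig) =
  \sum_(i' < n | nat_of_ord i' != i) tau (iter j (X i)) * tau (X i' \o iter l Sig) +
  \sum_(i' < n | nat_of_ord i' == i) tau (iter j.+1 (X i) \o iter l Sig).
Proof.
rewrite state_comp_iterS; last exact: alg_iter.
rewrite (bigID (fun i' : 'I_n => nat_of_ord i' == i)) [LHS]addrC /=; congr (_ + _).
  (* For j = 0 there is no first block to split off, and the factor is tau(id) = 1. *)
  apply: eq_bigr => i' i'i; case: j => [|j].
    by rewrite -[LHS]mul1r; congr (_ * _); exact/esym/(state_id (state_is_normal P)).
  apply: (@state_first_block l (i, j.+1) [::] (nat_of_ord i', 1%N)) => //=.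
  by rewrite /alt /= eq_sym i'i.
apply: eq_bigr => i' /eqP ->; congr tau.
by apply/funext => u /=; rewrite -iterSr.
Qed.

(** [eqX] concerns single variables only, but expanding Sig repeatedly expresses the mixed moment
    through single moments and n, in the same way for every i < n. *)
Lemma state_iter_comp_iter_eq i j l : (i < n)%N ->
  tau (iter j (X i) \o iter l Sig) = tau (iter j (X 0%N) \o iter l Sig).
Proof.
elim: l i j => [|l IH] i j ltin; first exact: eqX.
have n0 : (0 < n)%N by case: n ltin.
have sum_eq k (ltkn : (k < n)%N) (c : R[i]) :
    \sum_(i' < n | nat_of_ord i' == k) c = c.
  rewrite (bigD1 (Ordinal ltkn))//= big1 ?addr0// => i' /andP[/eqP i'k].
  by rewrite -val_eqE /= i'k eqxx.
have sum_ne k (ltkn : (k < n)%N) (c : R[i]) :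
    \sum_(i' < n | nat_of_ord i' != k) c = n%:R * c - c.
  apply: (addIr (\sum_(i' < n | nat_of_ord i' == k) c)).
  transitivity (\sum_(i' < n) c).
    by rewrite [RHS](bigID (fun i' : 'I_n => nat_of_ord i' == k)) [RHS]addrC.
  by rewrite sum_eq// subrK sumr_const card_ord mulr_natl.
have E k : (k < n)%N -> tau (iter j (X k) \o iter l.+1 Sig) =
    (n%:R * (tau (iter j (X 0%N)) * tau (X 0%N \o iter l Sig)) -
     tau (iter j (X 0%N)) * tau (X 0%N \o iter l Sig)) +
    tau (iter j.+1 (X 0%N) \o iter l Sig).
  move=> ltkn; rewrite state_iter_comp_iterS sum_eq// (IH k)// eqX -(sum_ne k)//.
  congr (_ + _); apply: eq_bigr => i' _; congr (_ * _).
  exact: (IH i' 1%N).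
by rewrite !E.
Qed.

(** The n - 1 indices other than 0 contribute equal terms m_j tau(X_i Sig^l), where m_j is the j-th
    moment of [X 0], and tau(Sig^(l+1)) is n times tau(X_i Sig^l); the ratio (n - 1)/n is the
    constant 1 - 1/n. *)
Lemma boolean_sum_recurrence j l : (0 < n)%N ->
  tau (iter j (X 0%N) \o iter l.+1 Sig) =
  tau (iter j.+1 (X 0%N) \o iter l Sig) +
  (1 - n%:R^-1) * tau (iter j (X 0%N)) * tau (iter l.+1 Sig).
Proof.
move=> n0; rewrite state_iter_comp_iterS addrC; congr (_ + _).
  rewrite (bigD1 (Ordinal n0))//= big1 ?addr0// => i' /andP[/eqP i'k].
  by rewrite -val_eqE /= i'k eqxx.
have eq1 (i : 'I_n) : tau (X i \o iter l Sig) = tau (X 0%N \o iter l Sig).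
  exact: (@state_iter_comp_iter_eq i 1%N l).
have -> : tau (iter l.+1 Sig) = n%:R * tau (X 0%N \o iter l Sig).
  rewrite -[iter l.+1 Sig]/(id \o iter l.+1 Sig) state_comp_iterS; last first.
    exact: (vna_id (alg_vna P)).
  by under eq_bigr do rewrite eq1; rewrite sumr_const card_ord mulr_natl.
rewrite -mulrA mulrCA mulrA -mulr_sumr -mulrA; congr (_ * _).
under eq_bigr do rewrite eq1.
rewrite mulrA mulrBl mul1r mulVf ?pnatr_eq0 -?lt0n// mulrBl mul1r.
rewrite -[X in _ = X - _](_ : \sum_(i < n) tau (X 0%N \o iter l Sig) = _); last first.
  by rewrite sumr_const card_ord mulr_natl.
rewrite [in RHS](bigD1 (Ordinal n0))//= addrC addrK.
by apply: eq_bigl => i; rewrite -val_eqE.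
Qed.

End BooleanSums.

(** * Shifting and rescaling moment sequences *)

Section MomentFormShift.
Variables (R : comNzRingType).
Implicit Types (m : nat -> R) (p q : {poly R}).

Lemma moment_formMX m p : moment_form m ('X * p) = moment_form (fun k => m k.+1) p.
Proof.
rewrite mulrC (@moment_form_widen _ _ (size p).+1); last first.
  by rewrite (leq_trans (size_polyMleq _ _))// size_polyX addn2.
rewrite big_ord_recl coefMX mul0r add0r.
by apply: eq_bigr => i _; rewrite coefMX.
Qed.

Lemma moment_form1 m : moment_form m 1 = m 0%N.
Proof. by rewrite -(moment_formXn m 0) expr0. Qed.

Lemma moment_form_scale r m p :
  moment_form (fun k => r ^+ k * m k) p = moment_form m (p \Po (r *: 'X)).
Proof.
pose L : {scalar {poly R}} := moment_form m \o comp_poly (r *: 'X).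
rewrite -[RHS]/(L p); apply: (@poly_linear_ext R R^o (moment_form _) L) => i.
rewrite [LHS]moment_formXn /L /= rmorphXn /= comp_polyX exprZn linearZ /=.
by rewrite moment_formXn.
Qed.

End MomentFormShift.

(** * The convolution identity between the two sequences of defect moments *)

Section ConvolutionIdentity.
Variables (R : comNzRingType) (m s : nat -> R) (b : nat -> nat -> R) (kappa d : R).
Hypothesis b0l : forall l, b 0 l = s l.
Hypothesis bj0 : forall j, b j 0 = m j.
Hypothesis b_rec : forall j l, b j l.+1 = b j.+1 l + kappa * m j * s l.+1.
Local Notation L := (moment_form m).
Local Notation Phi := (moment_form s).
Local Notation p := (1 - d *: 'X^2 : {poly R}).
Hypothesis L_odd : forall i, L ('X * p ^+ i) = 0.

(** For [b j l] = tau(X_1^j Sig^l) this is tau(u(X_1) v(Sig)). *)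
Let B (u v : {poly R}) := moment_form (fun j => moment_form (b j) v) u.

(** The bilinear extension of [b_rec]: the price of moving one factor ['X] from Sig to X_1. *)
Let BX u v : B u ('X * v) = B ('X * u) v + kappa * L u * Phi ('X * v).
Proof.
have LE (c : R) : kappa * L u * c = \sum_(j < size u) u`_j * (kappa * m j * c).
  by rewrite /moment_form mulr_sumr mulr_suml; apply: eq_bigr => j _; ring.
rewrite /B moment_formMX LE -big_split /=; apply: eq_bigr => j _.
rewrite -mulrDr; congr (_ * _); rewrite !moment_formMX.
rewrite /moment_form mulr_sumr -big_split /=; apply: eq_bigr => l _.
by rewrite b_rec; ring.
Qed.

(** Both factors ['X] of d X^2 are moved by [BX]. One of the two resulting terms contains L(X p^i)
    and vanishes by [L_odd]; in the other, d Phi(X^2 v) = Phi(v) - Phi(p v). *)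
Let B_defect i j : B (p ^+ i) (p ^+ j.+1) - B (p ^+ i.+1) (p ^+ j) =
  - kappa * (L (p ^+ i) * (Phi (p ^+ j) - Phi (p ^+ j.+1))).
Proof.
have XX u : p * u = u - d *: ('X * ('X * u)).
  by rewrite mulrBl mul1r -scalerAl expr2 mulrA.
have BXX u v : B u (p * v) - B (p * u) v = - kappa * d *
    (L u * Phi ('X * ('X * v)) + L ('X * u) * Phi ('X * v)).
  rewrite !XX; have Br w : B u (v - d *: w) = B u v - d * B u w.
    rewrite /B /moment_form mulr_sumr -sumrB; apply: eq_bigr => k _.
    by rewrite -!/(moment_form _ _) linearB linearZ /=; ring.
  have Bl w : B (u - d *: w) v = B u v - d * B w v.
    by rewrite /B linearB linearZ.
  by rewrite Br Bl !BX; ring.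
rewrite (exprS p i) (exprS p j) BXX L_odd mul0r addr0 XX.
by move: (p ^+ i) (p ^+ j) => u w; rewrite linearB linearZ /=; ring.
Qed.

Lemma convolution_identity k : L (p ^+ k) - Phi (p ^+ k) =
  kappa * \sum_(i < k) L (p ^+ i) * (Phi (p ^+ (k.-1 - i)) - Phi (p ^+ (k - i))).
Proof.
have BP u : B 1 u = Phi u.
  by rewrite /B moment_form1; apply: eq_bigr => l _; rewrite b0l.
have BL u : B u 1 = L u.
  by apply: eq_bigr => j _; rewrite moment_form1 bj0.
(* [T] transfers the k factors p one at a time, from all on Sig at i = 0 to all on X_1 at i = k. *)
pose T i := B (p ^+ i) (p ^+ (k - i)).
have -> : L (p ^+ k) - Phi (p ^+ k) = T k - T 0%N.
  by rewrite /T subn0 subnn expr0 BP BL.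
rewrite -(telescope_sumr T (leq0n k)) big_mkord mulr_sumr; apply: eq_bigr => i _.
have ki : (k - i = (k.-1 - i).+1)%N by have := ltn_ord i; lia.
have ki1 : (k - i.+1 = k.-1 - i)%N by rewrite subnS ki.
by rewrite /T ki1 ki -[LHS]opprB B_defect; ring.
Qed.

End ConvolutionIdentity.

(** * Summing a relation of renewal type *)

Section RenewalSeries.
Variables (R : realType) (kappa : R) (a b : nat -> R).
Hypotheses (kappa_ge0 : 0 <= kappa) (kappa_lt1 : kappa < 1).
Hypotheses (a_ge0 : forall k, 0 <= a k) (b_ge0 : forall k, 0 <= b k).
Hypotheses (b_le1 : forall k, b k <= 1) (b0 : b 0%N = 1).
Hypothesis ab : forall k,
  a k - b k = kappa * \sum_(i < k) a i * (b (k.-1 - i)%N - b (k - i)%N).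

(** The Cauchy product of [a] and [b] at k - 1, and 0 for k = 0. *)
Let conv k := \sum_(i < k) a i * b (k.-1 - i)%N.

(** Sum [ab] over k < N: for fixed i the differences of [b] telescope to b_0 - b_(N-1-i), and b_0 =
    1. *)
Lemma renewal_partial_sums N :
  \sum_(k < N) b k = (1 - kappa) * \sum_(k < N) a k + kappa * conv N.
Proof.
have -> : kappa * conv N = kappa * \sum_(k < N) a k -
    kappa * \sum_(i < N) a i * (1 - b (N.-1 - i)%N).
  rewrite -mulrBr -sumrB; congr (_ * _); apply: eq_bigr => i _.
  by rewrite mulrBr mulr1 opprB addrCA subrr addr0.
suff -> : kappa * \sum_(i < N) a i * (1 - b (N.-1 - i)%N) =
  \sum_(k < N) a k - \sum_(k < N) b k by ring.
elim: N => [|N IH]; first by rewrite !big_ord0 mulr0 subrr.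
rewrite [in RHS]big_ord_recr [X in _ - X]big_ord_recr /= opprD addrACA -IH ab.
rewrite big_ord_recr /= subnn b0 subrr mulr0 addr0 -mulrDr -big_split /=.
by congr (_ * _); apply: eq_bigr => i _; rewrite -mulrDr addrA subrK.
Qed.

(** Grouped by i, the left side is a sum over a triangle of index pairs; the right side is the sum
    of the same nonnegative terms over the enclosing square. *)
Lemma sum_conv_le M :
  \sum_(k < M) conv k <= (\sum_(k < M) a k) * (\sum_(k < M) b k).
Proof.
have -> : \sum_(k < M) conv k =
    \sum_(i < M) a i * \sum_(j < M.-1 - i) b j.
  elim: M => [|M IH]; first by rewrite !big_ord0.
  rewrite big_ord_recr IH [RHS]big_ord_recr /= subnn big_ord0 mulr0 addr0.
  rewrite -big_split /=; apply: eq_bigr => i _; rewrite -mulrDr.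
  case: M i {IH} => [[]//|M] i /=.
  by rewrite subSn ?big_ord_recr//= -ltnS.
rewrite mulr_suml ler_sum// => i _; rewrite ler_wpM2l//.
have Mi : (M.-1 - i <= M)%N by rewrite (leq_trans (leq_subr _ _))// leq_pred.
rewrite -!(big_mkord xpredT b) [leRHS](big_cat_nat (n := (M.-1 - i)%N))//=.
by rewrite lerDl sumr_ge0.
Qed.

Lemma renewal_nneseries :
  (\sum_(k <oo) (b k)%:E = (1 - kappa)%:E * \sum_(k <oo) (a k)%:E)%E.
Proof.
have k1 : 0 < 1 - kappa by rewrite subr_gt0.
have conv_ge0 k : 0 <= conv k by apply: sumr_ge0 => i _; rewrite mulr_ge0.
have sumE (u : nat -> R) N : \sum_(k < N) u k = series u N.
  by rewrite /series /= big_mkord.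
have ndser (u : nat -> R) : (forall k, 0 <= u k) ->
    nondecreasing_seq (series u).
  by move=> u0; apply/nondecreasing_seqP => N; rewrite seriesSr lerDl.
have [cva|dva] := pselect (cvgn (series a)).
  have conv_le k : conv k <= \sum_(k < k) a k.
    by apply: ler_sum => i _; rewrite ler_piMr.
  have ale N : series a N <= limn (series a).
    exact: nondecreasing_cvgn_le (ndser _ a_ge0) cva N.
  (* With [conv N] at most the N-th partial sum of [a], the convex combination in
     [renewal_partial_sums] is at most that sum too. *)
  have ble N : series b N <= limn (series a).
    rewrite -sumE renewal_partial_sums; apply: le_trans (ale N).
    rewrite -sumE -[leRHS]mul1r -[X in _ <= X * _](subrK kappa) [leRHS]mulrDl.
    by rewrite lerD2l ler_wpM2l.
  have a_lim0 : 0 <= limn (series a).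
    by apply: le_trans (ale 0%N); rewrite -sumE big_ord0.
  (* The Cauchy product of two summable sequences is summable, so its terms tend to 0 and drop out
     of the limit. *)
  have cvc : cvgn (series conv).
    apply: nondecreasing_is_cvgn; first exact: ndser.
    exists (limn (series a) * limn (series a)) => _ [N _ <-].
    rewrite -sumE (le_trans (sum_conv_le _))// !sumE ler_pM//.
    - by rewrite -sumE sumr_ge0.
    - by rewrite -sumE sumr_ge0.
  have c0 := cvg_series_cvg_0 cvc.
  have serb : series b = (fun N => (1 - kappa) * series a N + kappa * conv N).
    by apply/funext => N; rewrite -!sumE renewal_partial_sums.
  have bl : series b @ \oo --> (1 - kappa) * limn (series a).
    rewrite serb -[X in _ --> X]addr0 -[X in _ --> _ + X](mulr0 kappa).
    by apply: cvgD; apply: cvgMr.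
  have E (u : nat -> R) l : series u @ \oo --> l ->
      (\sum_(k <oo) (u k)%:E = l%:E)%E.
    move=> ul; apply: cvg_lim => //.
    under eq_fun do rewrite sumEFin.
    by apply/cvg_EFin; [exact: nearW|exact: ul].
  by rewrite (E _ _ bl) (E _ _ cva).
have pinfty (u : nat -> R) : (forall k, 0 <= u k) -> ~ cvgn (series u) ->
    (\sum_(k <oo) (u k)%:E = +oo)%E.
  move=> u0 du; apply: cvg_lim => //.
  under eq_fun do rewrite sumEFin.
  by apply/cvgeryP; apply: nondecreasing_dvgn_lt => //; exact: ndser.
(* If sum a diverges so does sum b: as [conv] is nonnegative, the partial sums of [b] dominate 1 -
   kappa > 0 times those of [a]. *)
rewrite (pinfty _ a_ge0 dva) (pinfty _ b_ge0); last first.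
  move=> cvb; apply: dva; apply: nondecreasing_is_cvgn; first exact: ndser.
  exists ((1 - kappa)^-1 * limn (series b)) => _ [N _ <-].
  rewrite ler_pdivlMl//; apply: le_trans (nondecreasing_cvgn_le (ndser _ b_ge0) cvb N).
  rewrite -sumE -[leRHS]sumE renewal_partial_sums lerDl mulr_ge0//.
by rewrite gt0_muley ?lte_fin.
Qed.

End RenewalSeries.

(** * The Hausdorff moment problem *)

Section BernsteinWeights.
Variables (R : realType) (L : {scalar {poly R}}).
Hypothesis L1 : L 1 = 1.
Hypothesis L_sqr : forall p, 0 <= L (p ^+ 2).
Hypothesis L_Xsqr : forall p, 0 <= L ('X * p ^+ 2).
Hypothesis L_1Xsqr : forall p, 0 <= L ((1 - 'X) * p ^+ 2).

(** Extracting even powers leaves a square times 1, X, 1 - X or X(1 - X). The last case reduces to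
    the others by X(1 - X) = X(1 - X)^2 + (1 - X)X^2. *)
Lemma bernstein_monomial_ge0 a b : 0 <= L ('X^a * (1 - 'X) ^+ b).
Proof.
rewrite -(odd_double_half a) -(odd_double_half b) -!muln2 !exprD !exprM.
set p := 'X ^+ a./2; set q := (1 - 'X) ^+ b./2.
have -> : 'X ^+ odd a * p ^+ 2 * ((1 - 'X) ^+ odd b * q ^+ 2) =
  'X ^+ odd a * (1 - 'X) ^+ odd b * (p * q) ^+ 2 by ring.
case: (odd a) (odd b) => [] []; rewrite ?expr1 ?expr0 ?mul1r ?mulr1//.
have -> : 'X * (1 - 'X) * (p * q) ^+ 2 =
  'X * ((1 - 'X) * (p * q)) ^+ 2 + (1 - 'X) * ('X * (p * q)) ^+ 2 by ring.
by rewrite linearD addr_ge0.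
Qed.

(** [L] of the k-th Bernstein basis polynomial of degree N, to be used as the mass at k/N of a
    discrete law. *)
Definition bernstein_weight N k := 'C(N, k)%:R * L ('X^k * (1 - 'X) ^+ (N - k)).
Local Notation c := bernstein_weight.

Lemma bernstein_weight_ge0 N k : 0 <= c N k.
Proof. by rewrite mulr_ge0// bernstein_monomial_ge0. Qed.

(** Expand X^j = (1 - X + X)^(N-j) X^j. Binomial moments of the weights are thus exact, unlike the
    power moments. *)
Lemma sum_bernstein_weight_bin N j : (j <= N)%N ->
  \sum_(k < N.+1) c N k * 'C(k, j)%:R = 'C(N, j)%:R * L 'X^j.
Proof.
move=> /subnK; set M := (N - j)%N => <-.
rewrite -(big_mkord xpredT (fun k => c (M + j) k * 'C(k, j)%:R)).
rewrite (big_cat_nat (n := j)) ?leqW ?leq_addl//= big_nat big1 ?add0r; last first.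
  by move=> k /andP[_ kj]; rewrite bin_small// mulr0.
rewrite -{1}[j]add0n big_addn subSn ?leq_addl// addnK big_mkord.
have -> : 'X^j = \sum_(i < M.+1)
    ('X^(i + j) * (1 - 'X) ^+ (M - i)) *+ 'C(M, i) :> {poly R}.
  transitivity ((1 - 'X + 'X) ^+ M * 'X^j : {poly R}).
    by rewrite subrK expr1n mul1r.
  rewrite exprDn mulr_suml; apply: eq_bigr => i _.
  by rewrite exprD mulrnAl; congr (_ *+ _); ring.
rewrite linear_sum mulr_sumr; apply: eq_bigr => i _.
have iM : (i <= M)%N by rewrite -ltnS.
rewrite linearMn /= /bernstein_weight subnDr -[L _ *+ _]mulr_natl mulrAC mulrA.
rewrite -!natrM.
congr (_%:R * _); apply/eqP.
(* After multiplication by j! i! (M - i)! both sides equal (M + j)!. *)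
rewrite -(eqn_pmul2r (fact_gt0 j)) -(eqn_pmul2r (fact_gt0 i)).
rewrite -(eqn_pmul2r (fact_gt0 (M - i))); apply/eqP.
have e1 := @bin_fact (M + j) (i + j); have e2 := @bin_fact (i + j) j.
have e3 := @bin_fact (M + j) j; have e4 := @bin_fact M i.
rewrite ?leq_add2r ?leq_addl ?subnDr ?addnK ?iM in e1 e2 e3 e4.
move: (e1 isT) (e2 isT) (e3 isT) (e4 isT) => {}e1 {}e2 {}e3 {}e4.
transitivity (M + j)`!; first by rewrite -e1 -e2; ring.
by rewrite -e3 -e4; ring.
Qed.

Lemma sum_bernstein_weight N : \sum_(k < N.+1) c N k = 1.
Proof.
have := sum_bernstein_weight_bin (leq0n N).
rewrite bin0 mul1r expr0 L1 => <-.
by apply: eq_bigr => k _; rewrite bin0 mulr1.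
Qed.

(** The ratio is the product over i < j of (k - i)/(N - i), whose factors differ from k/N by at most
    i/N; all factors lie in [0, 1], so the errors add up. *)
Lemma bin_ratio_approx (N k j : nat) : (j <= N)%N -> (k <= N)%N ->
  `|'C(k, j)%:R / 'C(N, j)%:R - (k%:R / N%:R) ^+ j| <= (j ^ 2)%:R / N%:R :> R.
Proof.
move=> + kN; have -> : 'C(k, j)%:R / 'C(N, j)%:R = (k ^_ j)%:R / (N ^_ j)%:R :> R.
  have j0 : (j`!)%:R != 0 :> R by rewrite pnatr_eq0 -lt0n fact_gt0.
  by rewrite -!bin_ffact !natrM -mulf_div divff// mulr1.
elim: j => [|j IH] jN.
  by rewrite !ffactn0 expr0 divr1 subrr normr0 divr_ge0.
have N0 : 0 < N%:R :> R by rewrite ltr0n (leq_trans _ jN).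
rewrite !ffactnSr !natrM -mulf_div exprSr.
set b := (k ^_ j)%:R / _; set y := (k - j)%:R / _; set x := k%:R / _.
set a := x ^+ j.
have -> : b * y - a * x = (b - a) * x + b * (y - x) by ring.
have x01 : 0 <= x <= 1.
  by rewrite divr_ge0//= ler_pdivrMr// mul1r ler_nat.
have b01 : 0 <= b <= 1.
  have Nj : 0 < (N ^_ j)%:R :> R by rewrite ltr0n ffact_gt0 ltnW.
  rewrite divr_ge0//= ler_pdivrMr// mul1r ler_nat.
  by rewrite !ffact_prod leq_prod// => i _; rewrite leq_sub2r.
have yx : `|y - x| <= j%:R / N%:R.
  have Nj : 0 < (N - j)%:R :> R by rewrite ltr0n subn_gt0.
  (* For k < j the truncated difference k - j is 0, and k/N alone is below j/N. *)
  have [jk|kj] := leqP j k; last first.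
    rewrite /y (eqP (ltnW kj : (k - j == 0)%N)) mul0r sub0r normrN ger0_norm ?(andP x01).1//.
    by rewrite ler_pM2r ?invr_gt0// ler_nat ltnW.
  rewrite /y /x !natrB// in Nj *; last exact: ltnW.
  have -> : (k%:R - j%:R) / (N%:R - j%:R) - k%:R / N%:R =
      - (j%:R / N%:R * ((N%:R - k%:R) / (N%:R - j%:R))) :> R.
    by field; rewrite !gt_eqF.
  have jN' : j%:R <= N%:R :> R by rewrite ler_nat ltnW.
  have kN' : k%:R <= N%:R :> R by rewrite ler_nat.
  have jk' : j%:R <= k%:R :> R by rewrite ler_nat.
  rewrite normrN ger0_norm ?mulr_ge0 ?invr_ge0 ?subr_ge0 ?(ltW Nj)//.
  rewrite ler_piMr ?divr_ge0// ler_pdivrMr// mul1r lerD2l lerN2//.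
apply: (le_trans (ler_normD _ _)); rewrite (normrM (b - a)) (normrM b).
rewrite (ger0_norm (andP x01).1) (ger0_norm (andP b01).1).
apply: (@le_trans _ _ ((j ^ 2)%:R / N%:R + j%:R / N%:R)); last first.
  rewrite -mulrDl ler_pM2r ?invr_gt0//. by rewrite -natrD -natrM ler_nat; nia.
apply: lerD.
  apply: le_trans (IH (ltnW jN)).
  by rewrite ler_piMr// (andP x01).2.
by apply: le_trans yx; rewrite ler_piMl// (andP b01).2.
Qed.

End BernsteinWeights.

(** * Quantile functions of discrete laws and their Riemann sums *)

Section DiscreteQuantile.
Variables (R : realType).

(** With y = F m, this counts the nodes i/m at which the indicator of [F, 1] equals 1. *)
Lemma count_ge_bounds (m : nat) (y : R) : 0 <= y <= m%:R ->
  m%:R - y - 1 <= \sum_(i < m) (y <= i%:R)%R%:R <= m%:R - y.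
Proof.
elim: m y => [|m IH] y /andP[y0 ym]; first by rewrite big_ord0; lra.
rewrite big_ord_recr /=; have [yle|ylt] := leP y m%:R.
  by have := IH y; rewrite y0 yle => /(_ isT); rewrite -natr1 /=; lra.
rewrite big1 ?add0r => [|i _]; last first.
  by rewrite leNgt (le_lt_trans _ ylt)// ler_nat ltnW.
by move: ym; rewrite -natr1 /=; lra.
Qed.

Variables (c : nat -> R) (N : nat).
Hypothesis c_ge0 : forall k, 0 <= c k.
Hypothesis c_sum : \sum_(k < N.+1) c k = 1.

(* The quantile function, at [u], of the law on [{0, ..., N}] with weights [c]. *)
Definition quantile_index (u : R) : nat :=
  \sum_(k < N) (\sum_(i < k.+1) c i <= u)%R.

Lemma quantile_index_le u : (quantile_index u <= N)%N.
Proof.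
rewrite /quantile_index -[leqRHS]card_ord -sum1_card leq_sum// => i _.
by case: (_ <= _).
Qed.

Lemma quantile_index_nondecreasing u v : u <= v ->
  (quantile_index u <= quantile_index v)%N.
Proof.
move=> uv; apply: leq_sum => k _.
by case: leP => // cu; rewrite (le_trans cu uv).
Qed.

(** The cumulative sums of [c] are nondecreasing, so the indicators equal to 1 form an initial
    segment of length [quantile_index u], over which the increments of [h] telescope. *)
Lemma fun_quantile_index (h : nat -> R) u : h (quantile_index u) =
  h 0%N + \sum_(k < N) (h k.+1 - h k) * (\sum_(i < k.+1) c i <= u)%R%:R.
Proof.
rewrite /quantile_index; elim: N => [|M IH]; first by rewrite !big_ord0 addr0.
rewrite big_ord_recr [in RHS]big_ord_recr /=; case: leP => cM; last first.
  by rewrite addn0 mulr0 addr0 IH.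
rewrite /= mulr1n mulr1 addrA -IH.
have -> : (\sum_(k < M) (\sum_(i < k.+1) c i <= u)%R = M)%N.
  rewrite -[RHS]card_ord -sum1_card; apply: eq_bigr => k _.
  rewrite (le_trans _ cM)//.
  rewrite -!(big_mkord xpredT c) [leRHS](big_cat_nat (n := k.+1))//=; last first.
    by rewrite ltnS ltnW.
  by rewrite lerDl sumr_ge0.
by rewrite addn1 addrC subrK.
Qed.

(** Abel summation, matching [fun_quantile_index] term by term: 1 - F_k is the integral over [0, 1]
    of the indicator of F_k <= u. *)
Lemma sum_by_parts (h : nat -> R) : \sum_(k < N.+1) c k * h k =
  h 0%N + \sum_(k < N) (h k.+1 - h k) * (1 - \sum_(i < k.+1) c i).
Proof.
rewrite -[X in _ = X + _]mulr1 -c_sum.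
pose S k := \sum_(i < k.+1) c i.
(* The total mass is kept as [S M], since it is known to be 1 only at M = N. *)
suff H M : \sum_(k < M.+1) c k * h k =
    h 0%N * S M + \sum_(k < M) (h k.+1 - h k) * (S M - S k) by exact: H.
elim: M => [|M IH]; first by rewrite /S !big_ord1 big_ord0 addr0 mulrC.
have SS : S M.+1 = S M + c M.+1 by rewrite /S big_ord_recr.
rewrite big_ord_recr IH [in RHS]big_ord_recr /= SS.
under [in RHS]eq_bigr => k _ do rewrite addrAC mulrDr.
rewrite big_split /= -mulr_suml.
rewrite -(big_mkord xpredT (fun k => h k.+1 - h k)) telescope_sumr//.
ring.
Qed.

(** Each indicator costs an error of at most 1/m in the Riemann sum; the errors are weighted by the
    nonnegative increments of [h], whose sum is h N - h 0. *)
Lemma quantile_riemann_sum (h : nat -> R) (m : nat) : (0 < m)%N ->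
  (forall k, (k < N)%N -> h k <= h k.+1) ->
  `|m%:R^-1 * \sum_(i < m) h (quantile_index (i%:R / m%:R)) -
    \sum_(k < N.+1) c k * h k| <= m%:R^-1 * (h N - h 0%N).
Proof.
move=> m0 hh; have m0' : 0 < m%:R :> R by rewrite ltr0n.
pose F k := \sum_(i < k.+1) c i.
have F01 (k : 'I_N) : 0 <= F k <= 1.
  rewrite sumr_ge0//= -c_sum /F -!(big_mkord xpredT c).
  rewrite [leRHS](big_cat_nat (n := k.+1))//=; last by rewrite ltnS ltnW.
  by rewrite lerDl sumr_ge0.
have cnt (k : 'I_N) :
  `|m%:R^-1 * \sum_(i < m) (F k <= i%:R / m%:R)%R%:R - (1 - F k)| <= m%:R^-1.
  have := @count_ge_bounds m (F k * m%:R).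
  have /andP[F0 F1] := F01 k.
  rewrite mulr_ge0 ?ler_piMl//= => /(_ isT).
  under eq_bigr do rewrite -ler_pdivlMr//.
  set S := \sum_(i < m) _ => /andP[S1 S2].
  have -> : m%:R^-1 * S - (1 - F k) = m%:R^-1 * (S - (m%:R - F k * m%:R)).
    by field; rewrite gt_eqF.
  rewrite normrM gtr0_norm ?invr_gt0// ler_piMr ?invr_ge0 ?(ltW m0')//.
  by rewrite ler_norml; lra.
under eq_bigr do rewrite fun_quantile_index.
rewrite big_split /= sumr_const card_ord mulrDr -[h 0%N *+ m]mulr_natl.
rewrite mulKf ?gt_eqF// exchange_big /= mulr_sumr sum_by_parts.
rewrite opprD addrACA subrr add0r -sumrB.
apply: (le_trans (ler_norm_sum _ _ _)).
apply: (@le_trans _ _ (\sum_(k < N) (h k.+1 - h k) * m%:R^-1)).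
  apply: ler_sum => k _; rewrite -mulr_sumr mulrCA -mulrBr normrM.
  by rewrite ger0_norm ?subr_ge0 ?hh// ler_wpM2l ?subr_ge0 ?hh// cnt.
rewrite -mulr_suml mulrC -(big_mkord xpredT (fun k => h k.+1 - h k)).
by rewrite telescope_sumr.
Qed.

End DiscreteQuantile.

(** A substitute for Helly selection: by compactness of [0, 1], every [f n x] converges along one
    and the same ultrafilter, for all x at once. *)
Lemma pointwise_ultra_limit (R : realType) (T : Type) (f : nat -> T -> R) :
    (forall n x, 0 <= f n x <= 1) ->
  exists2 U : set_system nat, UltraFilter U /\ \oo `<=` U &
    exists g : T -> R, forall x, f n x @[n --> U] --> g x.
Proof.
move=> f01; have [U [UU oU]] := ultraFilterLemma (@eventually_filter : ProperFilter \oo).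
exists U; first by split.
suff H : forall x, exists y : R, f n x @[n --> U] --> y.
  by exists (fun x => projT1 (cid (H x))) => x; case: cid.
move=> x; have : compact (`[0, 1]%classic : set R) by exact: segment_compact.
move=> /(_ (f n x @[n --> U])) [|y [_ fy]].
  by apply: (@filterE _ U _ (f ^~ x @^-1` _)) => n; rewrite /= in_itv /= f01.
exists y => V yV; have [//|UV] := in_ultra_setVsetC (f ^~ x @^-1` V) UU.
by have [z []] := fy (~` V) V UV yV.
Qed.

(** * Riemann sums of monotone functions *)

Section MonotoneRiemann.
Variables (R : realType) (h : R -> R).
Hypothesis h_nd : {homo h : x y / x <= y}.
Hypothesis h01 : forall x, 0 <= h x <= 1.
Local Notation leb := (@lebesgue_measure R).
Local Notation unif := (uniform_prob (@ltr01 R)).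

Let mh (D : set (measurableTypeR R)) : measurable D -> measurable_fun D h.
Proof. by move=> mD; exact: nondecreasing_measurable. Qed.

Let mEh (D : set (measurableTypeR R)) : measurable D ->
  measurable_fun D (fun x => (h x)%:E).
Proof. by move=> mD; apply/measurable_EFinP; exact: mh. Qed.

Let h_ge0 x : (0 <= (h x)%:E)%E.
Proof. by rewrite lee_fin; case/andP: (h01 x). Qed.

Let integral_cst_itv (a b r : R) : a <= b -> 0 <= r ->
  (\int[leb]_(x in `[a, b[) r%:E = (r * (b - a))%:E)%E.
Proof.
move=> ab r0; rewrite integral_cst//= lebesgue_measure_itv /= lte_fin.
have [ltab|] := ltP a b; first by rewrite EFinM EFinB.
by move=> ba; rewrite (le_anti (introT andP (conj ab ba))) subrr mulr0 mule0.
Qed.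

Lemma monotone_integral_bounds (d : R) (k : nat) : 0 < d ->
  ((\sum_(i < k) h (i%:R * d) * d)%:E <= \int[leb]_(x in `[0%R, (k%:R * d)%R[) (h x)%:E
   <= (\sum_(i < k) h (i.+1%:R * d) * d)%:E)%E.
Proof.
move=> d0; elim: k => [|k /andP[IH1 IH2]].
  by rewrite mul0r set_itvco0 integral_set0 !big_ord0 lexx.
have kd : k%:R * d <= k.+1%:R * d by rewrite ler_pM2r// ler_nat.
have kd0 : 0 <= k%:R * d by rewrite mulr_ge0// ltW.
have dE : k.+1%:R * d - k%:R * d = d by rewrite -mulrBl -natr1 addrAC subrr add0r mul1r.
rewrite (@itv_bndbnd_setU _ _ _ (BLeft (k%:R * d)) (BLeft (k.+1%:R * d))) ?bnd_simp//.
rewrite ge0_integral_setU//=; last 2 first.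
- by apply: mEh; exact: measurableU.
- rewrite disj_set2E; apply/eqP; rewrite -subset0 => x /= [].
  by rewrite !in_itv /= => /andP[_ xk] /andP[]; rewrite leNgt xk.
rewrite !big_ord_recr !EFinD /=; apply/andP; split; apply: leeD => //.
- rewrite -[X in (_ * X)%:E]dE -integral_cst_itv//; last by case/andP: (h01 (k%:R * d)).
  apply: ge0_le_integral => //=.
  + exact: mEh.
  + by move=> x; rewrite in_itv /= => /andP[kx _]; rewrite lee_fin h_nd.
- rewrite -[X in (_ * X)%:E]dE -integral_cst_itv//; last by case/andP: (h01 (k.+1%:R * d)).
  apply: ge0_le_integral => //=.
  + exact: mEh.
  + by move=> x; rewrite in_itv /= => /andP[_ kx]; rewrite lee_fin h_nd// ltW.
Qed.

Lemma integrable_monotone_uniform : unif.-integrable setT (fun x => (h x)%:E).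
Proof.
apply: (@le_integrable _ _ _ unif setT measurableT _ (EFin \o cst 1)) => //=.
- exact: mEh.
- by move=> x _; have /andP[h0 h1] := h01 x; rewrite !ger0_norm// lee_fin.
- exact: finite_measure_integrable_cst.
Qed.

(** The left and right Riemann sums enclose the integral and differ by (h 1 - h 0)/m. *)
Lemma riemann_sum_uniform m : (0 < m)%N ->
  `|\int[unif]_x h x - m%:R^-1 * \sum_(i < m) h (i%:R / m%:R)| <= m%:R^-1.
Proof.
move=> m0; have m0' : 0 < m%:R :> R by rewrite ltr0n.
have d0 : 0 < m%:R^-1 :> R by rewrite invr_gt0.
have E : (\int[unif]_x (h x)%:E = \int[leb]_(x in `[0%R, 1%R[) (h x)%:E)%E.
  rewrite integral_uniform//; last exact: mEh.
  by rewrite subr0 invr1 mul1e integral_itv_bndo_bndc//; exact: mEh.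
have := monotone_integral_bounds m d0; rewrite mulfV ?gt_eqF// -E.
rewrite -(fineK (integrable_fin_num measurableT integrable_monotone_uniform)).
rewrite !lee_fin -/(Rintegral _ _ _) => /andP[lo hi].
have tel : \sum_(i < m) h (i.+1%:R / m%:R) / m%:R =
    \sum_(i < m) h (i%:R / m%:R) / m%:R + (h 1 - h 0) / m%:R.
  rewrite -!mulr_suml -mulrDl; congr (_ / _); apply/eqP.
  rewrite addrC -subr_eq -sumrB.
  rewrite -(big_mkord xpredT (fun i => h (i.+1%:R / m%:R) - h (i%:R / m%:R))).
  by rewrite (telescope_sumr (fun i => h (i%:R / m%:R)))// mulfV ?(gt_eqF m0')// mul0r.
move: hi lo; rewrite tel -mulr_suml [_ * _^-1]mulrC => hi lo.
have h10 : (h 1 - h 0) / m%:R <= m%:R^-1.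
  rewrite ler_piMl ?(ltW d0)//.
  by have := h01 1; have := h01 0; lra.
rewrite ler_norml; lra.
Qed.

End MonotoneRiemann.

Section PolynomialIntegral.
Variables (R : realType) (mu : probability (measurableTypeR R) R).
Hypothesis int_mu : forall k, mu.-integrable setT (fun x : R => (x ^+ k)%:E).
Implicit Types p : {poly R}.

Let int_sum (a : nat -> R) n :
  mu.-integrable setT (fun x : R => (\sum_(i < n) a i * x ^+ i)%:E) /\
  \int[mu]_x (\sum_(i < n) a i * x ^+ i) =
  \sum_(i < n) a i * \int[mu]_x (x ^+ i : R).
Proof.
elim: n => [|n [IH1 IH2]].
  under eq_fun do rewrite big_ord0.
  split; first exact: (@finite_measure_integrable_cst _ _ _ mu setT 0).
  under eq_Rintegral do rewrite big_ord0.
  by rewrite big_ord0 Rintegral_cst// mul0r.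
have inta : mu.-integrable setT (fun x : R => (a n * x ^+ n)%:E).
  by under eq_fun do rewrite EFinM; exact: integrableZl.
split.
  under eq_fun do rewrite big_ord_recr EFinD /=.
  exact: integrableD.
under eq_Rintegral do rewrite big_ord_recr /=.
by rewrite RintegralD// IH2 big_ord_recr /= RintegralZl//; exact: int_mu.
Qed.

Lemma integrable_horner p : mu.-integrable setT (fun x : R => (p.[x])%:E).
Proof.
under eq_fun do rewrite horner_coef.
exact: (int_sum (fun i => p`_i) (size p)).1.
Qed.

Lemma integral_horner p :
  \int[mu]_x p.[x] = moment_form (fun k => \int[mu]_x (x ^+ k : R)) p.
Proof.
under eq_Rintegral do rewrite horner_coef.
exact: (int_sum (fun i => p`_i) (size p)).2.
Qed.

End PolynomialIntegral.

(** * The moment problem on the unit interval *)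

Section HausdorffUnit.
Variables (R : realType) (L : {scalar {poly R}}).
Hypothesis L1 : L 1 = 1.
Hypothesis L_sqr : forall p, 0 <= L (p ^+ 2).
Hypothesis L_Xsqr : forall p, 0 <= L ('X * p ^+ 2).
Hypothesis L_1Xsqr : forall p, 0 <= L ((1 - 'X) * p ^+ 2).
Local Notation c := (bernstein_weight L).

(** The quantile function of the law with mass [c N k] at k/N. *)
Let Q N (u : R) : R := (quantile_index (c N) N u)%:R / N%:R.

Let Q01 N u : 0 <= Q N u <= 1.
Proof.
rewrite /Q; case: N => [|N]; first by rewrite invr0 mulr0 lexx ler01.
by rewrite divr_ge0//= ler_pdivrMr ?ltr0n// mul1r ler_nat quantile_index_le.
Qed.

(** The function h(k) = C(k, j)/C(N, j) has mean exactly L(X^j) under the weights. The error 1/m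
    comes from the Riemann sum of h, and j^2/N from replacing h(k) by (k/N)^j. *)
Let Q_riemann_sum j m N : (0 < m)%N -> (j <= N)%N ->
  `|m%:R^-1 * \sum_(i < m) Q N (i%:R / m%:R) ^+ j - L 'X^j| <=
  m%:R^-1 + (j ^ 2)%:R / N%:R.
Proof.
move=> m0 jN; pose h k : R := 'C(k, j)%:R / 'C(N, j)%:R.
have C0 : 0 < 'C(N, j)%:R :> R by rewrite ltr0n bin_gt0.
have m0' : 0 < m%:R :> R by rewrite ltr0n.
have hL : \sum_(k < N.+1) c N k * h k = L 'X^j.
  under eq_bigr do rewrite mulrA.
  by rewrite -mulr_suml sum_bernstein_weight_bin// mulrC mulKf// gt_eqF.
have h_nd k : (k < N)%N -> h k <= h k.+1.
  by move=> _; rewrite ler_pM2r ?invr_gt0// ler_nat leq_bin2l.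
have := quantile_riemann_sum
  (bernstein_weight_ge0 L_sqr L_Xsqr L_1Xsqr N) (sum_bernstein_weight L1 N) m0 h_nd.
rewrite hL => riem.
have hN : h N - h 0%N <= 1.
  by rewrite lerBlDr /h divff ?gt_eqF// lerDl divr_ge0.
set S := _ * \sum_(i < m) h _ in riem; set S' := _ * _.
have SS : `|S' - S| <= (j ^ 2)%:R / N%:R.
  rewrite /S /S' -mulrBr -sumrB normrM gtr0_norm ?invr_gt0//.
  rewrite ler_pdivrMl//; apply: (le_trans (ler_norm_sum _ _ _)).
  apply: (@le_trans _ _ (\sum_(i < m) (j ^ 2)%:R / N%:R)); last first.
    by rewrite sumr_const card_ord [leRHS]mulr_natl lexx.
  apply: ler_sum => i _.
  by rewrite distrC bin_ratio_approx// quantile_index_le.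
have -> : S' - L 'X^j = (S - L 'X^j) + (S' - S) by ring.
apply: (le_trans (ler_normD _ _)); apply: lerD => //.
by apply: (le_trans riem); rewrite ler_piMr ?invr_ge0.
Qed.

(** [rho] is the law of the limit quantile function q under the uniform law. Integrals need not
    commute with limits along an ultrafilter, but finite Riemann sums do, and those of a monotone
    function approximate its integral. *)
Lemma hausdorff_moment_unit : exists2 rho : probability (measurableTypeR R) R,
  (forall k, rho.-integrable setT (fun x : R => (x ^+ k)%:E)) &
  forall k, \int[rho]_x (x ^+ k : R) = L 'X^k.
Proof.
have [U [UU oU] [q Qq]] := pointwise_ultra_limit Q01.
have U_near (A : set nat) : (\forall N \near \oo, A N) -> \forall N \near U, A N.
  exact: oU.
have q01 u : 0 <= q u <= 1.
  apply/andP; split.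
    by apply: (cvgr_to_ge (Qq u)); apply: nearW => N; case/andP: (Q01 N u).
  by apply: (cvgr_to_le (Qq u)); apply: nearW => N; case/andP: (Q01 N u).
have q_nd : {homo q : u v / u <= v}.
  move=> u v uv; apply: (ler_cvg_to (Qq u) (Qq v)); apply: nearW => N.
  by rewrite ler_wpM2r ?invr_ge0// ler_nat quantile_index_nondecreasing.
(* At fixed m the limit in N removes the error j^2/N. *)
have q_riemann j m : (0 < m)%N ->
    `|m%:R^-1 * \sum_(i < m) q (i%:R / m%:R) ^+ j - L 'X^j| <= m%:R^-1.
  move=> m0; apply/ler_addgt0Pr => e e0.
  have lim : `|m%:R^-1 * \sum_(i < m) Q N (i%:R / m%:R) ^+ j - L 'X^j| @[N --> U] -->
      `|m%:R^-1 * \sum_(i < m) q (i%:R / m%:R) ^+ j - L 'X^j|.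
    apply: cvg_norm; apply: cvgB; last exact: cvg_cst.
    apply: cvgM; first exact: cvg_cst.
    apply: cvg_big => [|i _]; first exact: add_continuous.
    have cX : {for q (i%:R / m%:R), continuous (fun x : R => x ^+ j)}.
      exact: exprn_continuous.
    have := cvg_comp _ _ (Qq (i%:R / m%:R)) cX.

    exact.
  apply: (cvgr_to_le lim); apply: U_near.
  exists (maxn j (Num.bound ((j ^ 2)%:R / e)).+1) => // N /=.
  rewrite geq_max => /andP[jN bN]; apply: (le_trans (Q_riemann_sum m0 jN)).
  have N0 : 0 < N%:R :> R by rewrite ltr0n (leq_trans _ bN).
  rewrite lerD2l ler_pdivrMr// mulrC -ler_pdivrMr//.
  have be : (j ^ 2)%:R / e <= (Num.bound ((j ^ 2)%:R / e))%:R.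
    by apply/ltW/archi_boundP; rewrite divr_ge0// ltW.
  by apply: (le_trans be); rewrite ler_nat ltnW.
have mq : measurable_fun setT (q : measurableTypeR R -> measurableTypeR R).
  exact: nondecreasing_measurable.
pose qm : {mfun measurableTypeR R >-> measurableTypeR R} :=
  HB.pack q (isMeasurableFun.Build _ _ _ _ _ mq).
pose unif : probability (measurableTypeR R) R := uniform_prob (@ltr01 R).
have qk_nd k : {homo (fun x => q x ^+ k) : u v / u <= v}.
  by move=> u v uv; rewrite lerXn2r ?nnegrE ?q_nd//; case/andP: (q01 u); case/andP: (q01 v).
have qk01 k x : 0 <= q x ^+ k <= 1.
  by case/andP: (q01 x) => q0 q1; rewrite exprn_ge0// exprn_ile1.
have mX k : measurable_fun setT (fun x : measurableTypeR R => (x ^+ k)%:E).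
  by apply/measurable_EFinP; exact: exprn_measurable.
have intq k := integrable_monotone_uniform (qk_nd k) (qk01 k).
exists (distribution unif qm) => k.
  exact: (integrable_pushforward mq (mX k) (intq k) measurableT).
rewrite /Rintegral (integral_distribution (P := unif) (X := qm) (mX k) (intq k)).
rewrite -/(Rintegral _ _ _) /=.
apply/eqP; rewrite -subr_eq0 -normr_le0; apply/ler_addgt0Pr => e e0; rewrite add0r.
pose m := (Num.bound (2 / e)).+1.
have m0 : 0 < m%:R :> R by rewrite ltr0n.
set I := Rintegral _ _ _.
set S := m%:R^-1 * \sum_(i < m) q (i%:R / m%:R) ^+ k.
have -> : I - L 'X^k = (I - S) + (S - L 'X^k) by ring.
apply: (le_trans (ler_normD _ _)).
apply: (@le_trans _ _ (m%:R^-1 + m%:R^-1)).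
  apply: lerD; last exact: q_riemann.
  exact: (riemann_sum_uniform (qk_nd k) (qk01 k)).
rewrite -mulr2n -[leLHS]mulr_natl ler_pdivrMr// mulrC -ler_pdivrMr//.
have be : 2 / e <= (Num.bound (2 / e))%:R.
  by apply/ltW/archi_boundP; rewrite divr_ge0// ltW.
by apply: (le_trans be); rewrite ler_nat.
Qed.

End HausdorffUnit.

Lemma moment_formE (R : comNzRingType) (L : {scalar {poly R}}) p :
  moment_form (fun k => L 'X^k) p = L p.
Proof.
apply: (@poly_linear_ext R R^o (moment_form (fun k => L 'X^k)) L) => i.
exact: moment_formXn.
Qed.

(** The affine map x -> (x + c)/(2c) carries [-c, c] onto [0, 1], which reduces the problem to the
    unit interval. *)
Lemma hausdorff_moment (R : realType) (L : {scalar {poly R}}) (c : R) :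
    0 < c -> L 1 = 1 -> (forall p, 0 <= L (p ^+ 2)) ->
    (forall p, 0 <= L (((c ^+ 2)%:P - 'X^2) * p ^+ 2)) ->
  exists2 rho : probability (measurableTypeR R) R,
    (forall k, rho.-integrable setT (fun x : R => (x ^+ k)%:E)) &
    forall k, \int[rho]_x (x ^+ k : R) = L 'X^k.
Proof.
move=> c0 L1 L_sqr L_csqr.
pose a : R := (2 * c)^-1; have a0 : 0 < a by rewrite invr_gt0 mulr_gt0.
have ac : a%:P * (2 * c%:P) = 1 :> {poly R}.
  by rewrite -(polyC_natr _ 2) -!polyCM mulVf// gt_eqF// mulr_gt0.
pose T : {poly R} := a%:P * ('X + c%:P).
pose L' : {scalar {poly R}} := L \o (comp_poly T).
have L'E p : L' p = L (p \Po T) by [].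
(* Here v is X + c or c - X, and 2c v = v^2 + (c^2 - X^2) gives positivity of T and of 1 - T. *)
have L_ge0 (u v e : {poly R}) : u = a%:P * v -> v ^+ 2 + ((c ^+ 2)%:P - 'X^2) = 2 * c%:P * v ->
    0 <= L (u * e ^+ 2).
  move=> uv vc; have -> : u * e ^+ 2 =
      (a ^+ 2) *: ((v * e) ^+ 2 + ((c ^+ 2)%:P - 'X^2) * e ^+ 2).
    rewrite exprMn -mulrDl vc uv -mul_polyC polyC_exp.
    transitivity (a%:P * v * e ^+ 2 * (a%:P * (2 * c%:P))); last by ring.
    by rewrite ac mulr1.
  by rewrite linearZ /= linearD /= mulr_ge0 ?addr_ge0 ?sqr_ge0.
have [rho int_rho mom_rho] : exists2 rho : probability (measurableTypeR R) R,
    (forall k, rho.-integrable setT (fun x : R => (x ^+ k)%:E)) &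
    forall k, \int[rho]_x (x ^+ k : R) = L' 'X^k.
  apply: hausdorff_moment_unit.
  - by rewrite L'E rmorph1.
  - by move=> p; rewrite L'E rmorphXn.
  - move=> p; rewrite L'E rmorphM rmorphXn /= comp_polyX.
    by apply: L_ge0 => //; rewrite polyC_exp; ring.
  - move=> p; rewrite L'E rmorphM rmorphXn rmorphB rmorph1 /= comp_polyX.
    apply: (@L_ge0 _ (c%:P - 'X)); last by rewrite polyC_exp; ring.
    by rewrite -ac /T; ring.
have rho_horner p : \int[rho]_x p.[x] = L' p.
  rewrite -[RHS](moment_formE L') integral_horner//.
  by apply: eq_bigr => i _; rewrite mom_rho.
(* [s] is the inverse of [T] as an affine map and transports [rho] back. *)
pose s : {poly R} := (2 * c)%:P * 'X - c%:P.
have mh (p : {poly R}) : measurable_fun setT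
    (fun x : measurableTypeR R => p.[x] : measurableTypeR R).
  by have /integrableP[/measurable_EFinP] := integrable_horner int_rho p.
pose sm : {mfun measurableTypeR R >-> measurableTypeR R} :=
  HB.pack (fun x : measurableTypeR R => s.[x] : measurableTypeR R)
    (isMeasurableFun.Build _ _ _ _ _ (mh s)).
have mX k : measurable_fun setT (fun x : measurableTypeR R => (x ^+ k)%:E).
  by apply/measurable_EFinP; exact: exprn_measurable.
have ints k : rho.-integrable setT (fun x : measurableTypeR R => (s.[x] ^+ k)%:E).
  by under eq_fun do rewrite -horner_exp; exact: integrable_horner.
exists (distribution rho sm) => k.
  exact: (integrable_pushforward (mh s) (mX k) (ints k) measurableT).
rewrite /Rintegral (integral_distribution (P := rho) (X := sm) (mX k) (ints k)).
rewrite -/(Rintegral _ _ _) /=.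
under eq_Rintegral do rewrite -horner_exp.
rewrite rho_horner L'E rmorphXn rmorphB rmorphM /= !comp_polyC comp_polyX.
congr (L (_ ^+ k)); rewrite /T polyCM.
transitivity ((a%:P * (2 * c%:P)) * ('X + c%:P) - c%:P); first by rewrite polyC_natr; ring.
by rewrite ac mul1r addrK.
Qed.

(** * The Fisher information as a series of moments *)

Lemma measurable_inve_sqr (R : realType) :
  measurable_fun setT (fun x : measurableTypeR R => ((x ^+ 2 : R)%:E)^-1%E).
Proof.
have -> : (fun x : R => ((x ^+ 2 : R)%:E)^-1%E) =
    (fun x : R => if x == 0 then +oo%E else ((x ^+ 2) `^ (-1))%:E).
  apply/funext => x; rewrite inver sqrf_eq0; case: eqP => // _.
  by rewrite powR_inv1// sqr_ge0.
apply: measurable_fun_ifT => //=.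
- by apply: measurable_fun_eqr => //; exact: measurable_cst.
- apply/measurable_EFinP.
  have msq : measurable_fun setT (fun x : measurableTypeR R => x ^+ 2 : measurableTypeR R).
    exact: exprn_measurable.
  have mpow : measurable_fun setT (fun x : measurableTypeR R => x `^ (-1) : measurableTypeR R).
    exact: measurable_powR.
  exact: (measurableT_comp mpow msq).
Qed.

(** A geometric series of ratio 1 - v y in [0, 1). For y = 0 all terms equal v > 0 and the sum is
    +oo, which is also the inverse of 0 in [\bar R]. *)
Lemma geometric_nneseries (R : realType) (v y : R) : 0 < v -> 0 <= y -> v * y <= 1 ->
  (\sum_(k <oo) (v * (1 - v * y) ^+ k)%:E = (y%:E)^-1)%E.
Proof.
move=> v0 y0 vy; rewrite inver; case: eqP => [->|/eqP yN0].
  rewrite mulr0 subr0; under eq_eseriesr do rewrite expr1n mulr1.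
  apply: cvg_lim => //; under eq_fun do rewrite sumEFin sumr_const_nat subn0.
  apply/cvgeryP/cvgryPge => M; near=> k; rewrite -mulr_natr mulrC -ler_pdivrMr//.
  by near: k; exact: nbhs_infty_ger.
apply: cvg_lim => //; under eq_fun do rewrite sumEFin.
apply: cvg_EFin; first exact: nearW.
have vy0 : 0 < v * y by rewrite mulr_gt0// lt_def yN0.
have := @cvg_geometric_series R v (1 - v * y).
rewrite opprB addrCA subrr addr0 invfM mulrA divff ?mul1r ?gt_eqF//; apply.
by rewrite ger0_norm ?subr_ge0// ltrBlDr ltrDl.
Unshelve. all: by end_near. Qed.

Section FisherSeries.
Variables (R : realType) (rho : probability (measurableTypeR R) R) (c v : R).
Hypothesis int_rho : forall k, rho.-integrable setT (fun x : R => (x ^+ k)%:E).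
Hypothesis mom_rho : forall k, \int[rho]_x (x ^+ (2 * k) : R) <= c ^+ (2 * k).
Hypotheses (v0 : 0 < v) (vc : v * c ^+ 2 < 1).

Let mhorner (p : {poly R}) : measurable_fun setT
  (fun x : measurableTypeR R => p.[x] : measurableTypeR R).
Proof. by have /integrableP[/measurable_EFinP] := integrable_horner int_rho p. Qed.

Let E := [set x : measurableTypeR R | 1 < v * x ^+ 2].

Let mE : measurable E.
Proof.
have -> : E = (fun x : measurableTypeR R => (v *: 'X^2).[x]) @^-1` `]1, +oo[.
  by apply/seteqP; split => x; rewrite /E /= !hornerE in_itv /= andbT.
rewrite -[X in measurable X]setTI; exact: mhorner.
Qed.

(** Markov's inequality at every order: the indicator of the set is at most (v x^2)^k, so its mass
    is at most (v c^2)^k, which tends to 0. *)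
Lemma law_support_negligible : rho [set x : measurableTypeR R | 1 < v * x ^+ 2] = 0.
Proof.
rewrite -/E; pose r := fine (rho E).
have rE : rho E = r%:E by rewrite fineK// fin_num_measure.
have c2 : 0 <= v * c ^+ 2 by rewrite mulr_ge0 ?sqr_ge0// ltW.
have rle k : r <= (v * c ^+ 2) ^+ k.
  rewrite -lee_fin -rE -[E]setIT -integral_indic//.
  apply: (@le_trans _ _ (\int[rho]_x (v ^+ k * x ^+ (2 * k))%:E)%E).
    apply: ge0_le_integral => //=.
    - by apply/measurable_EFinP; exact: measurable_indic.
    - apply/measurable_EFinP; have := mhorner (v ^+ k *: 'X^(2 * k)).
      by under eq_fun do rewrite hornerZ hornerXn.
    - move=> x _; rewrite lee_fin exprM -exprMn indicE.
      have x2 : 0 <= v * x ^+ 2 by rewrite mulr_ge0 ?sqr_ge0// ltW.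
      case: (boolP (x \in E)) => [|_]; last by rewrite exprn_ge0.
      by rewrite inE /E /= => /ltW x1; rewrite exprn_ege1.
  under eq_integral do rewrite EFinM.
  rewrite integralZl// -(fineK (integrable_fin_num measurableT (int_rho (2 * k)))).
  rewrite -EFinM lee_fin exprMn -exprM ler_wpM2l ?exprn_ge0 ?(ltW v0)//.
  exact: mom_rho.
rewrite rE; congr EFin; apply/eqP; rewrite eq_le; apply/andP; split; last first.
  by rewrite /r fine_ge0.
have : (GRing.exp (v * c ^+ 2) : R^nat) @ \oo --> (0 : R).
  by apply: cvg_expr; rewrite ger0_norm.
by move=> /cvgr_to_ge; apply; exact: nearW.
Qed.

Lemma ae_law_support : {ae rho, forall x : R, v * x ^+ 2 <= 1}.
Proof.
exists E; split => //; first exact: law_support_negligible.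
by move=> x /= /negP; rewrite -ltNge.
Qed.

Let ae_of_support (P : R -> Prop) : (forall x, v * x ^+ 2 <= 1 -> P x) ->
  {ae rho, forall x, setT x -> P x}.
Proof.
move=> vP; have [N [mN N0 subN]] := ae_law_support; exists N; split => //.
by apply: subset_trans subN => x /=; apply: contra_not => /vP.
Qed.

(** It agrees almost everywhere with 1 - v x^2 and is nonnegative everywhere, as termwise
    integration of the series requires. *)
Let w (x : R) := Num.max 0 (1 - v * x ^+ 2).

Let w_ge0 x : 0 <= w x. Proof. by rewrite le_max lexx. Qed.

Let wE x : v * x ^+ 2 <= 1 -> w x = 1 - v * x ^+ 2.
Proof. by move=> vx; apply/max_idPr; rewrite subr_ge0. Qed.

Let mw : measurable_fun setT (w : measurableTypeR R -> measurableTypeR R).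
Proof.
apply: measurable_maxr => //.
have -> : (fun x : R => 1 - v * x ^+ 2) = (fun x => (1 - v *: 'X^2).[x]).
  by apply/funext => x; rewrite !hornerE.
exact: mhorner.
Qed.

Let horner_defect k x : ((1 - v *: 'X^2) ^+ k).[x] = (1 - v * x ^+ 2) ^+ k.
Proof. by rewrite horner_exp !hornerE. Qed.

Let int_w k : (\int[rho]_x (w x ^+ k)%:E = (\int[rho]_x ((1 - v * x ^+ 2) ^+ k))%:E)%E.
Proof.
have int_d : rho.-integrable setT (fun x : R => ((1 - v * x ^+ 2) ^+ k)%:E).
  by under eq_fun do rewrite -horner_defect; exact: integrable_horner.
rewrite /Rintegral fineK; last exact: integrable_fin_num.
apply: ae_eq_integral => //.
- by apply/measurable_EFinP; exact: measurable_funX.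
- by case/integrableP: int_d.
- by apply: ae_of_support => x vx; rewrite wE.
Qed.

Lemma defect_moment_ge0_le1 k : 0 <= \int[rho]_x ((1 - v * x ^+ 2) ^+ k) <= 1.
Proof.
rewrite -!lee_fin -int_w; apply/andP; split.
  by apply: integral_ge0 => x _; rewrite lee_fin exprn_ge0.
rewrite -(@probability_setT _ _ _ rho) -[leRHS]mul1e -integral_cst//.
apply: ge0_le_integral => //=.
- by move=> x _; rewrite lee_fin exprn_ge0.
- by apply/measurable_EFinP; exact: measurable_funX.
- move=> x _; rewrite lee_fin exprn_ile1// ge_max ler01 gerBl.
  by rewrite mulr_ge0 ?sqr_ge0// ltW.
Qed.

(** The geometric expansion of 1/x^2 holds on v x^2 <= 1, hence almost everywhere, and is integrated
    termwise by monotone convergence. *)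
Lemma integral_inve_sqr :
  (\int[rho]_x ((x ^+ 2 : R)%:E)^-1 =
   v%:E * \sum_(k <oo) (\int[rho]_x ((1 - v * x ^+ 2) ^+ k))%:E)%E.
Proof.
transitivity (\int[rho]_x (\sum_(k <oo) (v * w x ^+ k)%:E))%E.
  apply: ge0_ae_eq_integral => //.
  - exact: measurable_inve_sqr.
  - apply: ge0_emeasurable_sum => [k x _ _|k _].
      by rewrite lee_fin mulr_ge0 ?exprn_ge0// ltW.
    by apply/measurable_EFinP; apply: measurable_funM => //; exact: measurable_funX.
  - by move=> x _; rewrite inve_ge0 lee_fin sqr_ge0.
  - by move=> x _; apply: nneseries_ge0 => k _ _; rewrite lee_fin mulr_ge0 ?exprn_ge0// ltW.
  apply: ae_of_support => x vx.
  by rewrite wE// geometric_nneseries ?sqr_ge0.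
rewrite integral_nneseries//.
- rewrite -nneseriesZl; last first.
    by move=> k _; rewrite lee_fin; case/andP: (defect_moment_ge0_le1 k).
  apply: eq_eseriesr => k _; rewrite -int_w.
  under eq_integral do rewrite EFinM.
  rewrite ge0_integralZl//.
  + by apply/measurable_EFinP; exact: measurable_funX.
  + by move=> x _; rewrite lee_fin exprn_ge0.
  + by rewrite lee_fin ltW.
- by move=> k; apply/measurable_EFinP; apply: measurable_funM => //; exact: measurable_funX.
- by move=> k x _; rewrite lee_fin mulr_ge0 ?exprn_ge0// ltW.
Qed.

End FisherSeries.

(** * Existence of laws and the Fisher series of a variable *)

Section LawOfVariable.
Variables (R : realType) (P : ncps R).
Implicit Types A : hilbert P -> hilbert P.

(** [law] is defined by choice, so a probability with the moments of [A] has to be exhibited;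
    positivity of the state solves the moment problem. *)
Lemma law_is_law A : nc_variable A -> is_law A (law A).
Proof.
move=> vA; have [c c0 Ac] := nc_variable_bounded vA.
have [|p|p|rho int_rho mom_rho] := @hausdorff_moment R (moment_form (op_moment A)) c c0.
- by rewrite /= moment_form1 op_moment0.
- exact: op_moment_sqr_ge0.
- exact: op_moment_bounded_ge0.
apply: (@getPex _ [set mu : probability (measurableTypeR R) R | is_law A mu]).
exists rho => k; split; first exact: int_rho.
by rewrite mom_rho /= moment_formXn state_iter_real.
Qed.

Lemma op_moment_law A mu k : is_law A mu -> op_moment A k = \int[mu]_x (x ^+ k : R).
Proof. by move=> /(_ k)[_]; rewrite /op_moment => ->. Qed.

(** Positivity of (c^2 - X^2) (X^k)^2 bounds each even moment by c^2 times the preceding one. *)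
Lemma op_moment_even_le A c k : nc_variable A ->
    (forall u, inner P (A u) (A u) <= (c ^+ 2)%:C * inner P u u) ->
  op_moment A (2 * k) <= c ^+ (2 * k).
Proof.
move=> vA Ac; elim: k => [|k IH]; first by rewrite muln0 op_moment0.
have := op_moment_bounded_ge0 'X^k vA Ac.
rewrite mulrBl mul_polyC -exprM -exprD linearB linearZ /= !moment_formXn.
rewrite subr_ge0 mulnC => le1; rewrite mulnS.
by rewrite exprD; apply: (le_trans le1); rewrite ler_wpM2l ?sqr_ge0.
Qed.

(** Expresses the Fisher information through moments alone, which is all that Boolean independence
    controls. *)
Lemma boolean_fisher_series A c v : nc_variable A ->
    (forall u, inner P (A u) (A u) <= (c ^+ 2)%:C * inner P u u) ->
    0 < v -> v * c ^+ 2 < 1 ->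
  let a k := moment_form (op_moment A) ((1 - v *: 'X^2) ^+ k) in
  (forall k, 0 <= a k <= 1) /\
  boolean_fisher A = (v%:E * \sum_(k <oo) (a k)%:E)%E.
Proof.
move=> vA Ac v0 vc; have lA := law_is_law vA.
have int_A k := (lA k).1.
have mom_A k : \int[law A]_x (x ^+ (2 * k) : R) <= c ^+ (2 * k).
  by rewrite -(op_moment_law _ lA); exact: op_moment_even_le.
have aE k : moment_form (op_moment A) ((1 - v *: 'X^2) ^+ k) =
    \int[law A]_x ((1 - v * x ^+ 2) ^+ k).
  transitivity (\int[law A]_x ((1 - v *: 'X^2) ^+ k).[x]); last first.
    by apply: eq_Rintegral => x _; rewrite horner_exp !hornerE.
  rewrite integral_horner// /moment_form; apply: eq_bigr => i _.
  by rewrite (op_moment_law _ lA).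
split=> [k|]; first by rewrite aE; exact: (defect_moment_ge0_le1 int_A mom_A).
rewrite /boolean_fisher (integral_inve_sqr int_A mom_A v0 vc).
by congr (_ * _)%E; apply: eq_eseriesr => k _; rewrite aE.
Qed.

End LawOfVariable.

Lemma symmetric_integral_odd (R : realType) (mu : probability (measurableTypeR R) R)
    (f : R -> R) : symmetric_law mu -> mu.-integrable setT (fun x : R => (f x)%:E) ->
  (forall x, f (- x) = - f x) -> \int[mu]_x f x = 0.
Proof.
move=> sym_mu int_f f_odd.
have mN : measurable_fun setT (-%R : measurableTypeR R -> measurableTypeR R).
  exact: oppr_measurable.
have mf : measurable_fun setT (fun x : measurableTypeR R => (f x)%:E).
  by case/integrableP: int_f.
have int_fN : mu.-integrable setT (fun x : measurableTypeR R => (f (- x))%:E).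
  by under eq_fun do rewrite f_odd EFinN; exact: integrableN.
have : \int[mu]_x f x = \int[mu]_x f (- x).
  rewrite /Rintegral; congr fine.
  rewrite -[RHS](integral_pushforward mN mf int_fN measurableT).
  apply: eq_measure_integral => B mB _.
  transitivity (mu (-%R @` B)); first exact/esym/sym_mu.
  rewrite /pushforward; congr (mu _).
  apply/seteqP; split => x /=; first by case=> y By <-; rewrite opprK.
  by move=> Bx; exists (- x) => //; rewrite opprK.
under [X in _ = X]eq_Rintegral do rewrite f_odd -mulN1r.
by rewrite RintegralZl// mulN1r => /eqP; rewrite -addr_eq0 -mulr2n mulrn_eq0 => /eqP.
Qed.

(** * Invariance of the Fisher information and entropy under normalized Boolean sums *)

Theorem theorem2p10 (R : realType) (P : ncps R)
    (X : nat -> hilbert P -> hilbert P)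
    (mu : probability (measurableTypeR R) R)
    (hX : forall i, nc_variable (X i))
    (hind : boolean_independent X)
    (hlaw : forall i, is_law (X i) mu)
    (hsym : symmetric_law mu)
    (n : nat) (hn : (1 <= n)%N) :
  boolean_entropy (normalized_sum X n) = boolean_entropy (X 0%N) /\
  boolean_fisher (normalized_sum X n) = boolean_fisher (X 0%N).
Proof.
suff fisher_eq : boolean_fisher (normalized_sum X n) = boolean_fisher (X 0%N).
  by rewrite /boolean_entropy fisher_eq.
set S := normalized_sum X n; set Sig := \sum_(i < n) X i.
have n0 : 0 < n%:R :> R by rewrite ltr0n.
have algX i : alg P (X i) := (hX i).1.
have vSig : nc_variable Sig.
  split; first exact: alg_sum.
  move=> u v; rewrite /Sig !fct_sumE linear_sumlz linear_sumr.
  by apply: eq_bigr => i _; exact: (hX i).2.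
pose r : R := (Num.sqrt n%:R)^-1.
have r2 : r ^+ 2 = n%:R^-1 by rewrite exprVn sqr_sqrtr ?ltW.
have vS : nc_variable S.
  split; first exact/algZ/vSig.1.
  move=> u v; rewrite linearZl_LR linearZr_LR /= vSig.2; congr (_ * _).
  by rewrite conj_Creal ?complex_real.
have momS k : op_moment S k = r ^+ k * op_moment Sig k.
  rewrite /op_moment (_ : iter k S = (r ^+ k)%:C *: iter k Sig); last first.
    by rewrite rmorphXn; exact/iter_scale/alg_linear/vSig.1.
  rewrite stateZ; last exact/alg_iter/vSig.1.
  by rewrite state_iter_real// -rmorphM.
have [c1 c1_gt0 Xc1] := nc_variable_bounded (hX 0%N).
have [c2 c2_gt0 Sc2] := nc_variable_bounded vS.
(* [D] exceeds both c1^2, a bound for X_1^2, and n c2^2, a bound for Sig^2 = n S_n^2; the summand 1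
   makes this strict. *)
pose D : R := c1 ^+ 2 + n%:R * c2 ^+ 2 + 1.
have c10 := sqr_ge0 c1; have c20 := sqr_ge0 c2.
have nc20 : 0 <= n%:R * c2 ^+ 2 by rewrite mulr_ge0.
have D0 : 0 < D by rewrite /D; lra.
have v1c : D^-1 * c1 ^+ 2 < 1 by rewrite mulrC ltr_pdivrMr// mul1r /D; lra.
have v2c : n%:R / D * c2 ^+ 2 < 1 by rewrite mulrAC ltr_pdivrMr// mul1r /D; lra.
have D'0 : 0 < D^-1 by rewrite invr_gt0.
have nD0 : 0 < n%:R / D by rewrite divr_gt0.
have [a01 fX] := boolean_fisher_series (hX 0%N) Xc1 D'0 v1c.
have [b01 fS] := boolean_fisher_series vS Sc2 nD0 v2c.
set p : {poly R} := 1 - D^-1 *: 'X^2 in a01 fX.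
(* The parameter n/D for S_n is chosen so that (n/D) S_n^2 = Sig^2/D: both series then involve the
   same polynomial p. *)
have bE k : moment_form (op_moment S) ((1 - (n%:R / D) *: 'X^2) ^+ k) =
    moment_form (op_moment Sig) (p ^+ k).
  rewrite (_ : moment_form (op_moment S) =
      moment_form (fun k => r ^+ k * op_moment Sig k)); last first.
    by congr moment_form; apply/funext.
  rewrite moment_form_scale rmorphXn rmorphB rmorph1 /= comp_polyZ rmorphXn /= comp_polyX.
  by rewrite exprZn scalerA r2 mulrAC mulfV ?gt_eqF// mul1r.
have L_odd i : moment_form (op_moment (X 0%N)) ('X * p ^+ i) = 0.
  rewrite (_ : op_moment (X 0%N) = fun k => \int[mu]_x (x ^+ k : R)); last first.
    by apply/funext => k; rewrite (op_moment_law _ (hlaw 0%N)).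
  rewrite -integral_horner; last by move=> k; exact: (hlaw 0%N k).1.
  apply: symmetric_integral_odd hsym _ _.
    by apply: integrable_horner => k; exact: (hlaw 0%N k).1.
  have pE y : p.[y] = 1 - D^-1 * y ^+ 2 by rewrite /p !hornerE.
  by move=> x; rewrite !hornerM !horner_exp !pE !hornerX sqrrN mulNr.
have momX i k : state P (iter k (X i)) = state P (iter k (X 0%N)).
  by rewrite (hlaw i k).2 (hlaw 0%N k).2.
pose kappa : R := 1 - n%:R^-1.
pose b j l := complex.Re (state P (iter j (X 0%N) \o iter l Sig)).
have b_rec j l : b j l.+1 = b j.+1 l +
    kappa * op_moment (X 0%N) j * op_moment Sig l.+1.
  rewrite /b boolean_sum_recurrence// !state_iter_real//.
  (* The correction term is real, so taking real parts preserves the recurrence. *)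
  rewrite (_ : 1 - n%:R^-1 = kappa%:C); last by rewrite rmorphB fmorphV rmorph_nat.
  by rewrite -!rmorphM; case: (state P _).
have conv := @convolution_identity R (op_moment (X 0%N)) (op_moment Sig) b kappa D^-1
  (fun=> erefl) (fun=> erefl) b_rec L_odd.
have kappa_ge0 : 0 <= kappa by rewrite subr_ge0 invf_le1// ler1n.
have kappa_lt1 : kappa < 1 by rewrite gtrBl invr_gt0.
have := @renewal_nneseries R kappa
  (fun k => moment_form (op_moment (X 0%N)) (p ^+ k))
  (fun k => moment_form (op_moment Sig) (p ^+ k)) kappa_ge0 kappa_lt1.
rewrite opprB addrCA subrr addr0 => renewal.
rewrite fS fX; under eq_eseriesr do rewrite bE.
rewrite renewal//.
(* The factor n/D of the series for S_n times 1 - kappa = 1/n is the factor 1/D of the series for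
   X_1. *)
- rewrite muleA -EFinM mulrAC mulfV ?gt_eqF// mul1r//.
- by move=> k; case/andP: (a01 k).
- by move=> k; rewrite -bE; case/andP: (b01 k).
- by move=> k; rewrite -bE; case/andP: (b01 k).
- by rewrite expr0 moment_form1 op_moment0.
Qed.
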